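(* For an infinite field $D$ of characteristic $\neq2$, the class of Kashiwara's Maslov cocycle $\tau$ and the Maslov class $[\mathsf m]$ (defined through the opposition graph) coincide in $H^2(\mathbf{Sp}_{2n}D;W\!D)$.
   Context: $D$ is a field of characteristic $\neq 2$, $M=D^{2n}$ carries the nondegenerate alternating form $h$ with block matrix $\begin{pmatrix}0&-1\\1&0\end{pmatrix}$, and $\mathbf{Sp}_{2n}D$ is its isometry group. A Lagrangian is a subspace $X\subseteq M$ with $X=X^\perp$; $\mathcal L$ is the set of Lagrangians. Two Lagrangians $X,Y$ are opposite if $X\cap Y=0$. $W\!D$ is the Witt group of nondegenerate symmetric bilinear forms over $D$; a quadratic form $q$ is identified with the symmetric bilinear form $b$ with $b(v,v)=q(v)$. Kashiwara's Maslov cocycle: for arbitrary Lagrangians $X,Y,Z$ let $q_{X,Y,Z}$ be the $3n$-dimensional quadratic form on $X\oplus Y\oplus Z$ given by $q_{X,Y,Z}(x,y,z)=h(x,y)+h(y,z)+h(z,x)$, and let $q^+_{X,Y,Z}$ be its nondegenerate part (the form induced modulo the radical). Fix $X_0\in\mathcal L$. Then $\tau:\mathbf{Sp}_{2n}D\times\mathbf{Sp}_{2n}D\to W\!D$, $\tau(g,g')=$ the class of $q^+_{X_0,g(X_0),gg'(X_0)}$ in $W\!D$, is an (inhomogeneous) group $2$-cocycle. Maslov class: for pairwise opposite Lagrangians $X,Y,Z$, choose a basis $x_1,\dots,x_n$ of $X$ and let $y_1,\dots,y_n$ be the basis of $Y$ with $h(y_\mu,x_\nu)=\delta_{\mu\nu}$;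 then $Z$ has a unique basis $y_\nu+\sum_\mu x_\mu t_{\mu\nu}$ with $t$ nonsingular and symmetric, and $\kappa(X,Y,Z)$ is the isomorphism class of $t$ (well defined). The opposition graph $\Gamma$ has the Lagrangians as vertices and pairs of opposite Lagrangians as edges. $Fl(\Gamma)$ is the simplicial set whose $k$-simplices are tuples of vertices that are pairwise equal or adjacent, with $\mathbb Z$-free chain complex $C_*$, and $\tilde C_*$ is its quotient complex of alternating chains $\langle x_0,\dots,x_k\rangle$ (antisymmetric, zero if two entries coincide). The Maslov cocycle is the invariant $2$-cocycle $\mathsf m:\langle X,Y,Z\rangle\mapsto[\kappa(X,Y,Z)]\in W\!D$. With $G=\mathbf{Sp}_{2n}D$, a projective resolution $P_*\to\mathbb Z$ of $G$ with augmentation $\eta:P_0\to\mathbb Z$ and a trivial coefficient group $A$, $H^*_G(C_*;A)$ is the cohomology of $\mathrm{Hom}_{\mathbb Z}(P_*\otimes_GC_*,A)$; a $G$-invariant cochain $c$ is viewed as $p\otimes z\mapsto\eta(p)c(z)$ on $P_0\otimes_GC_*$ (zero on the other components). For $D$ infinite, $Fl(\Gamma)$ is acyclic and the constant map $Fl(\Gamma)\to pt$ induces $H^*(G;A)\cong H^*_G(Fl(\Gamma);A)$; via this isomorphism $\mathsf m$ defines the Maslov class $[\mathsf m]\in H^2(\mathbf{Sp}_{2n}D;W\!D)$. *)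

(* Defs.v *)
From HB Require Import structures.
From mathcomp Require Import freeg.
From mathcomp Require Import all_boot all_order all_algebra.
From mathcomp Require Import boolp classical_sets cardinality.

Set Implicit Arguments.
Unset Strict Implicit.
Unset Printing Implicit Defensive.

Import GRing.Theory.
Local Open Scope ring_scope.

Section LinearExtension.
Variables (K : choiceType) (A : zmodType) (f : K -> A).

Definition zextend (c : {freeg K}) : A :=
  fglift (f : K -> zmodule A) c.

Fact zextend_is_zmod_morphism : zmod_morphism zextend.
Proof. exact: (@lift_is_additive _ K (zmodule A) f). Qed.

HB.instance Definition _ :=
  GRing.isZmodMorphism.Build {freeg K} A zextend zextend_is_zmod_morphism.

Lemma zextendU k : zextend << k >> = f k.
Proof. by rewrite /zextend liftU scale1r. Qed.

End LinearExtension.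

Lemma freeg_morph_ext (K : choiceType) (A : zmodType)
    (f g : {additive {freeg K} -> A}) :
  (forall k, f << k >> = g << k >>) -> f =1 g.
Proof.
move=> fg c; rewrite -[c]freeg_sumE !raddf_sum; apply: eq_bigr => k _.
by rewrite -[coeff k c]intz -freegU_mulz !raddfMz fg.
Qed.

Record gmod (G : groupType) := GMod {
  gmod_sort :> zmodType;
  gact : G -> gmod_sort -> gmod_sort;
  gact_zmod_morphism : forall g, zmod_morphism (gact g);
  gact1 : forall x, gact 1%g x = x;
  gactM : forall g g' x, gact (g * g')%g x = gact g (gact g' x)
}.

Definition gequivariant (G : groupType) (M N : gmod G) (f : M -> N) : Prop :=
  forall g x, f (gact g x) = gact g (f x).

Record gcomplex (G : groupType) := GComplex {
  chain :> nat -> gmod G;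
  bd : forall k, {additive chain k.+1 -> chain k};
  bd_equivariant : forall k, gequivariant (bd k);
  bdK : forall k (x : chain k.+2), bd k (bd k.+1 x) = 0
}.
Arguments bd {G C k} : rename.
Arguments bdK {G C k} x : rename.

Definition gprojective (G : groupType) (Q : gmod G) : Prop :=
  forall (M N : gmod G) (p : {additive M -> N}) (f : {additive Q -> N}),
    gequivariant p -> gequivariant f -> (forall y, exists x, p x = y) ->
  exists f' : {additive Q -> M}, gequivariant f' /\ forall x, p (f' x) = f x.

Record gresolution (G : groupType) := GResolution {
  res_complex :> gcomplex G;
  res_projective : forall k, gprojective (res_complex k);
  aug : {additive res_complex 0%N -> int};
  aug_invariant : forall g x, aug (gact g x) = aug x;
  aug_surjective : forall z, exists x, aug x = z;
  aug_bd : forall x : res_complex 1%N, aug (bd x) = 0;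
  res_exact0 : forall x, aug x = 0 -> exists y : res_complex 1%N, bd y = x;
  res_exactS : forall k (x : res_complex k.+1),
    bd x = 0 -> exists y : res_complex k.+2, bd y = x
}.
Arguments aug {G P} : rename.

Record ggraph (G : groupType) := GGraph {
  vertex :> choiceType;
  adj : rel vertex;
  adj_sym : symmetric adj;
  vact : G -> vertex -> vertex;
  vact1 : forall x, vact 1%g x = x;
  vactM : forall g g' x, vact (g * g')%g x = vact g (vact g' x);
  adj_vact : forall g x y, adj (vact g x) (vact g y) = adj x y
}.

Section FlagComplex.
Variables (G : groupType) (T : ggraph G).

Definition pairwise_eq_adj k (s : {ffun 'I_k.+1 -> T}) : bool :=
  [forall i, forall j, (s i == s j) || adj (s i) (s j)].

Record flag_simplex k := FlagSimplex {
  vertices :> {ffun 'I_k.+1 -> T};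
  _ : pairwise_eq_adj vertices
}.

HB.instance Definition _ k := [isSub for @vertices k].
HB.instance Definition _ k := [Choice of flag_simplex k by <:].

Fact face_subproof k (i : 'I_k.+2) (s : flag_simplex k.+1) :
  pairwise_eq_adj [ffun j : 'I_k.+1 => s (lift i j)].
Proof.
apply/forallP => a; apply/forallP => b; rewrite !ffunE.
by have /forallP/(_ (lift i a))/forallP := valP s; apply.
Qed.

Definition face k (i : 'I_k.+2) (s : flag_simplex k.+1) : flag_simplex k :=
  FlagSimplex (face_subproof i s).

Fact simplex_act_subproof k g (s : flag_simplex k) :
  pairwise_eq_adj [ffun j : 'I_k.+1 => vact g (s j)].
Proof.
apply/forallP => a; apply/forallP => b; rewrite !ffunE adj_vact.
have /forallP/(_ a)/forallP/(_ b)/orP[/eqP->|->] := valP s; first by rewrite eqxx.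
by rewrite orbT.
Qed.

Definition simplex_act k g (s : flag_simplex k) : flag_simplex k :=
  FlagSimplex (simplex_act_subproof g s).

Definition flag_act k g : {freeg (flag_simplex k)} -> {freeg (flag_simplex k)} :=
  zextend (fun s => << simplex_act g s >>).

Fact flag_act1 k (x : {freeg (flag_simplex k)}) : flag_act 1%g x = x.
Proof.
apply: (freeg_morph_ext (f := zextend _) (g := idfun)) => s /=.
rewrite zextendU; congr << _ >>; apply/val_inj/ffunP => j.
by rewrite ffunE vact1.
Qed.

Fact flag_actM k g g' (x : {freeg (flag_simplex k)}) :
  flag_act (g * g')%g x = flag_act g (flag_act g' x).
Proof.
apply: (freeg_morph_ext (f := zextend _) (g := zextend _ \o zextend _)) => s /=.
rewrite !zextendU; congr << _ >>; apply/val_inj/ffunP => j.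
by rewrite !ffunE vactM.
Qed.

Definition flag_chain k : gmod G :=
  GMod (fun g => zextend_is_zmod_morphism
                   (fun s : flag_simplex k => << simplex_act g s >>))
       (@flag_act1 k) (@flag_actM k).

Definition flag_bd k : flag_chain k.+1 -> flag_chain k :=
  zextend (fun s => \sum_(i < k.+2) << face i s >> *~ (-1) ^+ i).

HB.instance Definition _ k := GRing.Additive.on (@flag_bd k).

Fact flag_bd_equivariant k : gequivariant (@flag_bd k).
Proof.
move=> g; apply: (freeg_morph_ext (f := zextend _ \o zextend _)
                                  (g := zextend _ \o zextend _)) => s /=.
rewrite !zextendU raddf_sum; apply: eq_bigr => i _.
rewrite raddfMz /= zextendU; congr (<< _ >> *~ _).
by apply/val_inj/ffunP => j; rewrite !ffunE.
Qed.

Fact faceK k (i : 'I_k.+3) (j : 'I_k.+2) (s : flag_simplex k.+2) : (j < i)%N ->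
  face j (face i s) = face (inord i.-1) (face (inord j) s).
Proof.
move=> ji; apply/val_inj/ffunP => m; rewrite !ffunE; congr (s _).
have im : (i.-1 < k.+2)%N by case: (val i) (ltn_ord i) ji.
apply: val_inj => /=; rewrite !inordK //; last exact: ltnW (ltn_ord _).
case: (val i) ji => // a ja; rewrite bumpC.
have -> : bump a.+1 j = j by rewrite /bump leqNgt ja.
by rewrite /unbump ja subn1.
Qed.

Fact flag_bdK k (x : flag_chain k.+2) : flag_bd (flag_bd x) = 0.
Proof.
apply: (freeg_morph_ext (f := zextend _ \o zextend _) (g := \0)) => s /=.
rewrite zextendU raddf_sum /=.
under eq_bigr => i _.
  rewrite raddfMz /= zextendU -/(_ *~ _) mulrz_suml.
  under eq_bigr => j _ do rewrite -mulrzA.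
  over.
rewrite pair_big /= (bigID (fun p : 'I_k.+3 * 'I_k.+2 => p.2 < p.1)%N) /=.
apply/eqP; rewrite addr_eq0 -sumrN; apply/eqP.
rewrite [RHS](reindex_onto
  (fun p : 'I_k.+3 * 'I_k.+2 => (inord p.2, inord p.1.-1))
  (fun p : 'I_k.+3 * 'I_k.+2 => (inord p.2.+1, inord p.1))) /=; last first.
  move=> [a b] /=; rewrite -leqNgt => ab.
  have ak : (a < k.+2)%N by apply: leq_ltn_trans ab (ltn_ord b).
  by rewrite (inordK ak) (@inordK k.+2 b.+1) ?ltnS ?leq_ord //= !inord_val.
apply: eq_big => [[i j]|[i j]] /=; last first.
  move=> ji; have i0 : (0 < i)%N by apply: leq_ltn_trans ji.
  have im : (i.-1 < k.+2)%N by rewrite -ltnS prednK.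
  have jm : (j < k.+3)%N by apply: ltnW (ltn_ord _).
  rewrite faceK // -mulrNz; congr (_ *~ _).
  have -> : (-1) ^+ i = - (-1) ^+ i.-1 :> int.
    by rewrite -[in LHS](prednK i0) exprS mulN1r.
  by rewrite !inordK // mulrN mulrC.
have jm : (j < k.+3)%N by apply: ltnW (ltn_ord _).
rewrite (inordK jm); have [ji|ij] := ltnP j i.
  have i0 : (0 < i)%N by apply: leq_ltn_trans ji.
  have im : (i.-1 < k.+2)%N by rewrite -ltnS prednK.
  by rewrite !inordK // prednK // -ltnNge ji !inord_val eqxx.
apply/esym/negbTE; rewrite negb_and negbK.
have im : (i.-1 < k.+2)%N by apply: leq_ltn_trans (leq_pred i) (leq_ltn_trans ij _).
rewrite inordK //; case: (posnP i) => [i0|i0]; last by rewrite prednK // (leq_trans _ ij) ?prednK.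
apply/orP; right; rewrite xpair_eqE negb_and; apply/orP; left.
by rewrite -val_eqE /= inordK ?i0.
Qed.

Definition flag_complex : gcomplex G :=
  GComplex flag_bd_equivariant flag_bdK.

(* The map on 0-chains induced by the constant map to a point. *)
Definition flag_aug : flag_complex 0%N -> int := @deg _.

End FlagComplex.

(* The flag complex of the complete graph on [G], with [G] acting by left
   translation, is the homogeneous standard resolution [Z[G^(k+1)]]. *)

Definition complete_graph (G : groupType) : ggraph G :=
  @GGraph G G (fun _ _ => true) (fun _ _ => erefl) (fun g x => (g * x)%g)
    (@mul1g G) (fun g g' x => esym (mulgA g g' x)) (fun _ _ _ => erefl).

Definition bar_complex (G : groupType) : gcomplex G :=
  flag_complex (complete_graph G).

(* Augmentation-preserving chain maps [P -> bar_complex G]: they exist and are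
   unique up to equivariant homotopy, and so identify [H^*(G; A)] computed from
   the bar complex with [H^*(G; A)] computed from [P]. *)
Record bar_comparison (G : groupType) (P : gresolution G) := BarComparison {
  to_bar :> forall k, {additive P k -> bar_complex G k};
  to_bar_equivariant : forall k, gequivariant (to_bar k);
  to_bar_bd : forall k (x : P k.+1), to_bar k (bd x) = bd (to_bar k.+1 x);
  to_bar_aug : forall x, flag_aug (to_bar 0%N x) = aug x
}.

Section Cohomology.
Variables (G : groupType) (P : gresolution G) (A : zmodType).

(* [Hom_G(P_k, A) = Hom_Z(P_k (x)_G Z, A)] *)
Definition is_group_cochain k (f : P k -> A) : Prop :=
  zmod_morphism f /\ forall g x, f (gact g x) = f x.

Definition is_group_cocycle k (f : P k -> A) : Prop :=
  is_group_cochain f /\ forall x : P k.+1, f (bd x) = 0.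

(* An element of [H^(k+1)(G; A)] is represented as a coset of the group of
   coboundaries; this is the coset of [f]. *)
Definition group_class k (f : P k.+1 -> A) : set (P k.+1 -> A) :=
  [set f' | exists2 a : P k -> A,
     is_group_cochain a & forall x, f' x = f x + a (bd x)]%classic.

(* The cochain on [P_2] defined by an inhomogeneous cochain [c : G x G -> A]:
   [c] corresponds to [(g_0, g_1, g_2) |-> c (g_0^-1 g_1) (g_1^-1 g_2)]. *)
Definition of_inhomogeneous (phi : bar_comparison P) (c : G -> G -> A)
    (x : P 2%N) : A :=
  zextend (fun s : flag_simplex (complete_graph G) 2%N =>
             c ((s ord0)^-1 * s (inord 1))%g ((s (inord 1))^-1 * s ord_max)%g)
          (phi 2%N x).

Variable C : gcomplex G.

(* By the universal property of [(x)_G] (for the diagonal action), an element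
   of [Hom_Z(P_p (x)_G C_q, A)] is a biadditive map [P_p x C_q -> A] that is
   invariant under [G].  A cochain of degree [k] is given by its components
   with [p + q = k]; the other components are irrelevant. *)
Definition bicochain := forall p q, P p -> C q -> A.

Definition is_bicochain (F : bicochain) : Prop :=
  forall p q,
    [/\ forall y, zmod_morphism (fun x => F p q x y),
        forall x, zmod_morphism (F p q x)
      & forall g x y, F p q (gact g x) (gact g y) = F p q x y].

(* The transpose of the differential [dx (x) y + (-1)^p x (x) dy]. *)
Definition bicoboundary (F : bicochain) : bicochain := fun p q x y =>
  (if p is p'.+1 return P p -> A then fun x => F p' q (bd x) y
   else fun=> 0) x +
  (if q is q'.+1 return C q -> A then fun y => F p q' x (bd y)
   else fun=> 0) y *~ (-1) ^+ p.

Definition bicohomologous k (F F' : bicochain) : Prop :=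
  exists2 B, is_bicochain B &
    forall p q, (p + q = k)%N -> forall x y,
      F p q x y - F' p q x y = bicoboundary B x y.

(* An invariant 2-cochain [c] of [C] as the cochain [p (x) z |-> eta(p) c(z)]. *)
Definition of_invariant (c : C 2%N -> A) : bicochain := fun p q =>
  match p, q return P p -> C q -> A with
  | 0%N, 2%N => fun x y => c y *~ aug x
  | _, _ => fun _ _ => 0
  end.

(* Pull-back of 2-cochains along the map [C -> Z] given by [eps : C_0 -> Z]. *)
Definition const_pullback (eps : C 0%N -> int) (f : P 2%N -> A) : bicochain :=
  fun p q =>
  match p, q return P p -> C q -> A with
  | 2%N, 0%N => fun x y => f x *~ eps y
  | _, _ => fun _ _ => 0
  end.

End Cohomology.

Section WittGroup.
Variable D : fieldType.

Record nsform k := NSForm {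
  nsmx :> 'M[D]_k;
  _ : (nsmx^T == nsmx) && (nsmx \in unitmx)
}.

HB.instance Definition _ k := [isSub for @nsmx k].
HB.instance Definition _ k := [Choice of nsform k by <:].

Definition form_gen k (t : nsform k) : {freeg {k : nat & nsform k}} :=
  << Tagged nsform t >>.

Inductive witt_relator : {freeg {k : nat & nsform k}} -> Prop :=
| WittIsometry k (t t' : nsform k) (g : 'M_k) of
    g \in unitmx & t = g^T *m t' *m g :> 'M_k :
    witt_relator (form_gen t - form_gen t')
| WittSum k l (t : nsform k) (u : nsform l) (v : nsform (k + l)) of
    v = block_mx t 0 0 u :> 'M_(k + l) :
    witt_relator (form_gen v - (form_gen t + form_gen u))
| WittHyperbolic k (t : nsform (k + k)) of
    t = block_mx 0 1%:M 1%:M 0 :> 'M_(k + k) :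
    witt_relator (form_gen t).

Definition witt_null : {pred {freeg {k : nat & nsform k}}} := fun c =>
  `[< forall S : pred {freeg {k : nat & nsform k}}, zmod_closed S ->
        (forall r, witt_relator r -> r \in S) -> c \in S >].

Fact witt_null_zmod_closed : zmod_closed witt_null.
Proof.
split; first by apply/asboolP => S [].
move=> x y /asboolP Sx /asboolP Sy; apply/asboolP => S Scl Srel.
by case: (Scl) => _; apply; [apply: Sx|apply: Sy].
Qed.

HB.instance Definition _ :=
  GRing.isZmodClosed.Build _ witt_null witt_null_zmod_closed.

(* The quotient of the Grothendieck group by the hyperbolic forms; this is the
   Witt group only in characteristic <> 2. *)
Definition witt : zmodType := {ideal_quot witt_null}%type.

Definition witt_class k (t : nsform k) : witt :=
  \pi_({ideal_quot witt_null})%qT (form_gen t).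

Section NondegeneratePart.
Variables (k : nat) (S : 'M[D]_k).

(* The rows form a basis of a complement of the radical of [S], i.e. they
   represent a basis of the quotient by the radical. *)
Definition radical_compl := row_base ((kermx S)^C)%MS.

Definition nondeg_mx := radical_compl *m S *m radical_compl^T.

Hypothesis S_sym : S^T = S.

Fact nondeg_mx_subproof :
  (nondeg_mx^T == nondeg_mx) && (nondeg_mx \in unitmx).
Proof.
have sym : nondeg_mx^T = nondeg_mx.
  rewrite /nondeg_mx; move: radical_compl => B.
  by rewrite !trmx_mul trmxK S_sym mulmxA.
rewrite sym eqxx -row_free_unit -kermx_eq0 /=; set v := kermx nondeg_mx.
have vN : v *m radical_compl *m S *m radical_compl^T = 0.
  by have := mulmx_ker nondeg_mx; rewrite /nondeg_mx !mulmxA.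
set w := v *m radical_compl *m S in vN.
have wK : w *m (kermx S)^T = 0.
  have SK : S *m (kermx S)^T = 0 by rewrite -{1}S_sym -trmx_mul mulmx_ker trmx0.
  by rewrite /w -mulmxA SK mulmx0.
have w0 : w = 0.
  have : (1%:M <= kermx S + radical_compl)%MS.
    apply: (submx_trans (submx_full _ (addsmx_compl_full (kermx S)))).
    by rewrite addsmxS // eq_row_base.
  case/sub_addsmxP => -[a b] /= def1; rewrite -[w]mulmx1 -trmx1 def1.
  by rewrite linearD /= (trmx_mul a) (trmx_mul b) mulmxDr !mulmxA wK vN !mul0mx addr0.
rewrite -(mulmx_free_eq0 v (row_base_free (kermx S)^C)%MS) -submx0.
rewrite -(capmx_compl (kermx S)) sub_capmx; apply/andP; split.
  exact/sub_kermxP.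
by apply: submx_trans (submxMl _ _) _; rewrite eq_row_base.
Qed.

Definition nondeg_part : nsform _ := NSForm nondeg_mx_subproof.

End NondegeneratePart.

Section QuadraticForm.
Variables (V : vectType D) (q : V -> D).

Definition polar (u v : V) : D := (q (u + v) - q u - q v) / 2%:R.

Definition gram : 'M[D]_(\dim {:V}) :=
  \matrix_(i, j) polar (vbasis {:V})`_i (vbasis {:V})`_j.

Fact gram_sym : gram^T = gram.
Proof.
apply/matrixP => i j; rewrite !mxE /polar; congr (_ / _).
by rewrite addrAC; congr (q _ - _ - _); rewrite addrC.
Qed.

Definition nondeg_class : witt := witt_class (nondeg_part gram_sym).

End QuadraticForm.

End WittGroup.

Section Symplectic.
Variables (D : fieldType) (n : nat).

Notation M := 'cV[D]_(n + n).

Definition symp_mx : 'M[D]_(n + n) := block_mx 0 (- 1%:M) 1%:M 0.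

Definition symp_form (u v : M) : D := (u^T *m symp_mx *m v) 0 0.

(* Matrices of isometries, acting on column vectors from the left. *)
Record Sp := SpElt {
  sp_mx :> 'M[D]_(n + n);
  _ : sp_mx^T *m symp_mx *m sp_mx == symp_mx
}.

HB.instance Definition _ := [isSub for sp_mx].
HB.instance Definition _ := [Choice of Sp by <:].

Lemma sp_mxP (g : Sp) : g^T *m symp_mx *m g = symp_mx.
Proof. exact/eqP/(valP g). Qed.

Lemma sp_unitmx (g : Sp) : (g : 'M_(n + n)) \in unitmx.
Proof.
have JJ : (- symp_mx) *m symp_mx = 1%:M.
  rewrite mulNmx /symp_mx mulmx_block !mul0mx !mulmx0 !addr0 !add0r mulNmx.
  by rewrite !(mul1mx, mulmx1) opp_block_mx !opprK oppr0 -scalar_mx_block.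
have /mulmx1_unit[] // : (- symp_mx *m g^T *m symp_mx) *m g = 1%:M.
by rewrite -!mulmxA (mulmxA g^T) sp_mxP.
Qed.

Fact sp_mul_subproof (g g' : Sp) :
  (g *m g')^T *m symp_mx *m (g *m g') == symp_mx.
Proof.
by rewrite trmx_mul -!mulmxA (mulmxA g^T) (mulmxA (g^T *m _)) sp_mxP mulmxA sp_mxP.
Qed.

Fact sp_one_subproof : 1%:M^T *m symp_mx *m 1%:M == symp_mx.
Proof. by rewrite trmx1 mul1mx mulmx1. Qed.

Fact sp_inv_subproof (g : Sp) :
  (invmx g)^T *m symp_mx *m invmx g == symp_mx.
Proof.
rewrite -{1}(sp_mxP g) trmx_inv -!mulmxA mulmxV ?sp_unitmx // mulmx1 mulmxA.
by rewrite mulVmx ?mul1mx // unitmx_tr sp_unitmx.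
Qed.

Definition sp_mul g g' := SpElt (sp_mul_subproof g g').
Definition sp_one := SpElt sp_one_subproof.
Definition sp_inv g := SpElt (sp_inv_subproof g).

Fact sp_mulA : associative sp_mul.
Proof. by move=> a b c; apply: val_inj; rewrite /= mulmxA. Qed.
Fact sp_mul1 : left_id sp_one sp_mul.
Proof. by move=> a; apply: val_inj; rewrite /= mul1mx. Qed.
Fact sp_mulr1 : right_id sp_one sp_mul.
Proof. by move=> a; apply: val_inj; rewrite /= mulmx1. Qed.
Fact sp_mulV : left_inverse sp_one sp_inv sp_mul.
Proof. by move=> a; apply: val_inj; rewrite /= mulVmx ?sp_unitmx. Qed.
Fact sp_mulVr : right_inverse sp_one sp_inv sp_mul.
Proof. by move=> a; apply: val_inj; rewrite /= mulmxV ?sp_unitmx. Qed.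

HB.instance Definition _ :=
  isGroup.Build Sp sp_mulA sp_mul1 sp_mulr1 sp_mulV sp_mulVr.

Definition is_lagrangian (X : {vspace M}) : bool :=
  `[< forall v, v \in X <-> (forall u, u \in X -> symp_form u v = 0) >].

Record lagrangian := Lagrangian {
  lag_space :> {vspace M};
  _ : is_lagrangian lag_space
}.

HB.instance Definition _ := [isSub for lag_space].
HB.instance Definition _ := [Choice of lagrangian by <:].

Definition opposite (X Y : lagrangian) : bool := (X :&: Y == 0)%VS.

Definition sp_lfun (g : Sp) : 'End(M) := linfun (mulmx g).

Fact symp_form_sp (g : Sp) u v :
  symp_form (sp_lfun g u) (sp_lfun g v) = symp_form u v.
Proof.
rewrite !lfunE /symp_form /= trmx_mul -!mulmxA (mulmxA g^T) (mulmxA (_ *m _) g).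
by rewrite sp_mxP.
Qed.

Fact sp_lfun1 : sp_lfun 1%g = \1%VF.
Proof. by apply/lfunP => v; rewrite !lfunE /= mul1mx. Qed.

Fact sp_lfunM g g' : sp_lfun (g * g')%g = (sp_lfun g \o sp_lfun g')%VF.
Proof. by apply/lfunP => v; rewrite comp_lfunE !lfunE /= mulmxA. Qed.

Fact sp_lfunVK g : cancel (sp_lfun g^-1%g) (sp_lfun g).
Proof. by move=> v; rewrite -comp_lfunE -sp_lfunM mulgV sp_lfun1 lfunE. Qed.

Fact sp_lfunK g : cancel (sp_lfun g) (sp_lfun g^-1%g).
Proof. by move=> v; rewrite -comp_lfunE -sp_lfunM mulVg sp_lfun1 lfunE. Qed.

Fact mem_sp_lfun g (X : {vspace M}) v :
  (v \in sp_lfun g @: X)%VS = (sp_lfun g^-1%g v \in X).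
Proof.
apply/memv_imgP/idP => [[u uX ->]|vX]; first by rewrite sp_lfunK.
by exists (sp_lfun g^-1%g v); rewrite ?sp_lfunVK.
Qed.

Fact lag_act_subproof g (X : lagrangian) : is_lagrangian (sp_lfun g @: X)%VS.
Proof.
apply/asboolP => v; rewrite mem_sp_lfun; have /asboolP -> := valP X; split.
  by move=> hv u; rewrite mem_sp_lfun => /hv; rewrite symp_form_sp.
by move=> hv u uX; rewrite -(symp_form_sp g) sp_lfunVK hv // mem_sp_lfun sp_lfunK.
Qed.

Definition lag_act g X := Lagrangian (lag_act_subproof g X).

Fact lag_act1 X : lag_act 1%g X = X.
Proof. by apply: val_inj; rewrite /= sp_lfun1 lim1g. Qed.

Fact lag_actM g g' X : lag_act (g * g')%g X = lag_act g (lag_act g' X).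
Proof. by apply: val_inj; rewrite /= sp_lfunM limg_comp. Qed.

Fact opposite_sym : symmetric opposite.
Proof. by move=> X Y; rewrite /opposite capvC. Qed.

Fact opposite_act g X Y : opposite (lag_act g X) (lag_act g Y) = opposite X Y.
Proof.
have g0 : lker (sp_lfun g) == 0%VS by apply/lker0P/can_inj/sp_lfunK.
by rewrite /opposite /= -lker0_img_cap // -lkerE (eqP g0) subv0.
Qed.

Definition opposition_graph : ggraph Sp :=
  GGraph opposite_sym lag_act1 lag_actM opposite_act.

Definition kashiwara_form (X Y Z : lagrangian)
    (w : subvs_of X * subvs_of Y * subvs_of Z) : D :=
  let: (x, y, z) := w in
  symp_form (vsval x) (vsval y) + symp_form (vsval y) (vsval z) +
  symp_form (vsval z) (vsval x).

Definition kashiwara_cocycle (X0 : lagrangian) (g g' : Sp) : witt D :=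
  nondeg_class (@kashiwara_form X0 (lag_act g X0) (lag_act (g * g')%g X0)).

Definition is_kappa (X Y Z : lagrangian) (t : nsform D n) : Prop :=
  exists x y : n.-tuple M,
    [/\ basis_of X x, basis_of Y y,
        forall mu nu : 'I_n, symp_form (tnth y mu) (tnth x nu) = (mu == nu)%:R
      & basis_of Z [seq tnth y nu + \sum_mu t mu nu *: tnth x mu
                    | nu <- enum 'I_n]].

Definition kappa_class (X Y Z : lagrangian) : witt D :=
  xget 0 [set w | exists2 t, is_kappa X Y Z t & w = witt_class t]%classic.

(* The pull-back to all chains of the cochain on alternating chains, whence
   the value 0 if two vertices coincide.  Pairwise distinct vertices of a
   simplex are pairwise opposite. *)
Definition maslov_cochain : flag_complex opposition_graph 2%N -> witt D :=
  zextend (fun s : flag_simplex opposition_graph 2%N =>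
    if injectiveb s then kappa_class (s ord0) (s (inord 1)) (s ord_max) else 0).

Section Classes.
Variable P : gresolution Sp.

Definition kashiwara_class (phi : bar_comparison P) (X0 : lagrangian) :
    set (P 2%N -> witt D) :=
  group_class (of_inhomogeneous phi (kashiwara_cocycle X0)).

(* The inverse image of the class of [maslov_cochain] under the isomorphism
   from [H^2(G; A)] to [H^2_G(Fl; A)] that is induced by [Fl -> pt], again as
   a coset of the group of coboundaries. *)
Definition maslov_class : set (P 2%N -> witt D) :=
  [set f | is_group_cocycle f /\
           bicohomologous 2%N (const_pullback (@flag_aug _ opposition_graph) f)
                            (of_invariant maslov_cochain)]%classic.

End Classes.

End Symplectic.

Arguments kashiwara_class {D n P} phi X0.
Arguments maslov_class {D n} P.

(* Main.v *)
From HB Require Import structures.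
Require Import Defs.
From mathcomp Require Import freeg.
From mathcomp Require Import all_boot all_order all_algebra.
From mathcomp Require Import ring.
From mathcomp Require Import boolp classical_sets functions cardinality.

Set Implicit Arguments.
Unset Strict Implicit.
Unset Printing Implicit Defensive.

Import GRing.Theory.
Local Open Scope ring_scope.

(**
The idea is that both cocycles are restrictions of one function. Let
[kashiwara_index X Y Z] be the Witt class of Kashiwara's form, for arbitrary
Lagrangians. It is invariant, satisfies the cocycle identity on all quadruples
of Lagrangians, vanishes when two of its arguments coincide, and equals
[kappa(X, Y, Z)] on pairwise opposite triples. So on the flag complex of the
opposition graph it is the Maslov cocycle, while on an orbit
[(g_0, g_1, g_2) |-> (g_0 X_0, g_1 X_0, g_2 X_0)] it is the homogeneous form of
Kashiwara's cocycle. Evaluating it on mixed triples, with some entries in the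
orbit and the others vertices of a flag simplex, gives an explicit primitive of
the difference of the two in the double complex ([orbit_class]).

The cocycle identity becomes transparent once some Lagrangian [W] opposite to
all the Lagrangians involved is available. Fix a basis of [W]; each [X] opposite
to [W] then has a unique basis dual to it. The matrices [pairing A_X A_Y] of the
symplectic form between two such bases are symmetric, change sign when [X] and
[Y] are exchanged, and those of [(X, Y)], [(Y, Z)] and [(Z, X)] have sum zero. A
linear change of variables turns Kashiwara's form into the orthogonal sum of
these three matrices ([kashiwara_index_dual]). So the index is a sum of three
terms, one for each edge of the triangle [X, Y, Z], and in the cocycle identity
the edge terms cancel in pairs. When instead [X] itself plays the role of [W], the same computation leaves the
matrix of [kappa(X, Y, Z)] plus a hyperbolic form ([kashiwara_index_kappa]).

A common opposite [W] of finitely many Lagrangians exists over an infinite field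
([common_opposite]): an isotropic subspace of dimension less than [n] that meets
each of them trivially can be enlarged, because a vector space over an infinite
field is not a finite union of proper subspaces. The same statement lets every
cycle of the flag complex be coned off, whence acyclicity ([flag_exact0],
[flag_exactS]).

This shows that Kashiwara's class lies in the set of classes that pull back to
the Maslov cocycle. That this set is a single class is the injectivity of
[H^2(G; A) -> H^2_G(Fl; A)] ([const_pullback_inj]), which rests on exactness of
the augmented flag complex in degrees 0 and 1 and on projectivity of [P_0].
*)

(** * Additive and biadditive maps on free abelian groups *)

Lemma freeg_zmod_morphism_ext (K : choiceType) (A : zmodType) (f g : {freeg K} -> A) :
  zmod_morphism f -> zmod_morphism g -> (forall k, f << k >> = g << k >>) -> f =1 g.
Proof.
move=> fB gB.
pose f_add : {additive {freeg K} -> A} := HB.pack f (GRing.isZmodMorphism.Build _ _ f fB).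
pose g_add : {additive {freeg K} -> A} := HB.pack g (GRing.isZmodMorphism.Build _ _ g gB).
exact: (freeg_morph_ext (f := f_add) (g := g_add)).
Qed.

Lemma freeg_biadditive_ext (K L : choiceType) (A : zmodType)
    (F F' : {freeg K} -> {freeg L} -> A) :
  (forall y, zmod_morphism (F ^~ y)) -> (forall x, zmod_morphism (F x)) ->
  (forall y, zmod_morphism (F' ^~ y)) -> (forall x, zmod_morphism (F' x)) ->
  (forall k l, F << k >> << l >> = F' << k >> << l >>) ->
  forall x y, F x y = F' x y.
Proof.
move=> Fl Fr F'l F'r FF' x y.
apply: (freeg_zmod_morphism_ext (Fl y) (F'l y)) => k.
by apply: (freeg_zmod_morphism_ext (Fr _) (F'r _)).
Qed.

Lemma freeg_ext_in (K : choiceType) (A : zmodType) (f g : {additive {freeg K} -> A}) c :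
  (forall k, k \in dom c -> f << k >> = g << k >>) -> f c = g c.
Proof.
move=> fg; rewrite -[c]freeg_sumE !raddf_sum big_seq [RHS]big_seq.
apply: eq_bigr => k kc; rewrite -[coeff k c]intz -freegU_mulz !raddfMz.
by rewrite fg.
Qed.

Lemma zextend_cst (K : choiceType) (A : zmodType) (a : A) (c : {freeg K}) :
  zextend (fun=> a) c = a *~ deg c.
Proof.
rewrite -[c]freeg_sumE !raddf_sum /=; apply: eq_bigr => k _.
by rewrite -[coeff k c]intz -freegU_mulz !raddfMz /= zextendU degU.
Qed.

Section BilinearExtension.
Variables (K L : choiceType) (A : zmodType).

Lemma zextendBf (f g : K -> A) c :
  zextend (fun k => f k - g k) c = zextend f c - zextend g c.
Proof.
by apply: (freeg_morph_ext (f := zextend _) (g := zextend f \- zextend g)) => k;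
  rewrite /= !zextendU.
Qed.

Definition biextend (c : K -> L -> A) x y := zextend (fun k => zextend (c k) y) x.

Lemma biextendU c k y : biextend c << k >> y = zextend (c k) y.
Proof. exact: zextendU. Qed.

Lemma biextend_morphl c y : zmod_morphism (biextend c ^~ y).
Proof. exact: zextend_is_zmod_morphism. Qed.

Lemma biextend_morphr c x : zmod_morphism (biextend c x).
Proof.
move=> y y'; rewrite /biextend -zextendBf; congr (zextend _ x).
by apply/funext => k; rewrite raddfB.
Qed.

End BilinearExtension.

(** * Group cohomology and cochains on a complex with group action *)

Section VanishingHom.
Variables (G : groupType) (C : gmod G) (A : zmodType) (Z : C -> Prop).
Hypothesis Z_stable : forall g z, Z z -> Z (gact g z).

(** The additive maps [C -> A] that vanish on a stable set [Z]; for [Z] empty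
    this is [Hom(C, A)], and for [Z] the cycles it is [Hom(im d, A)], the two
    modules between which a lift is needed below. *)
Definition vanishing_hom_pred : {pred C -> A} := fun phi =>
  `[< zmod_morphism phi /\ forall z, Z z -> phi z = 0 >].

Fact vanishing_hom_zmod_closed : zmod_closed vanishing_hom_pred.
Proof.
split; first by apply/asboolP; split=> [x y|//] /=; rewrite subrr.
move=> phi psi /asboolP[phiB phiZ] /asboolP[psiB psiZ]; apply/asboolP.
have subE x : (phi - psi) x = phi x - psi x by [].
split=> [x y|z Zz]; rewrite !subE; last by rewrite phiZ ?psiZ ?subrr.
by rewrite phiB psiB !opprD addrACA.
Qed.

HB.instance Definition _ :=
  GRing.isZmodClosed.Build _ vanishing_hom_pred vanishing_hom_zmod_closed.

Record vanishing_hom := VanishingHom {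
  hom_fun :> C -> A;
  _ : hom_fun \in vanishing_hom_pred
}.

HB.instance Definition _ := [isSub for hom_fun].
HB.instance Definition _ := [Choice of vanishing_hom by <:].
HB.instance Definition _ := [SubChoice_isSubZmodule of vanishing_hom by <:].

Lemma vanishing_homP (phi : vanishing_hom) :
  zmod_morphism phi /\ forall z, Z z -> phi z = 0.
Proof. exact/asboolP/(valP phi). Qed.

Fact hom_act_subproof g (phi : vanishing_hom) :
  (fun x => phi (gact g^-1%g x)) \in vanishing_hom_pred.
Proof.
have [phiB phiZ] := vanishing_homP phi.
by apply/asboolP; split=> [x y|z /Z_stable /phiZ//]; rewrite gact_zmod_morphism phiB.
Qed.

Definition hom_act g phi := VanishingHom (hom_act_subproof g phi).

Fact hom_act_zmod_morphism g : zmod_morphism (hom_act g).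
Proof. by move=> phi psi; apply: val_inj. Qed.

Fact hom_act1 phi : hom_act 1%g phi = phi.
Proof. by apply/val_inj/funext => x /=; rewrite invg1 gact1. Qed.

Fact hom_actM g g' phi : hom_act (g * g')%g phi = hom_act g (hom_act g' phi).
Proof. by apply/val_inj/funext => x /=; rewrite invgM gactM. Qed.

Definition hom_gmod : gmod G := GMod hom_act_zmod_morphism hom_act1 hom_actM.

End VanishingHom.

Section GroupHypercohomology.
Variables (G : groupType) (P : gresolution G) (A : zmodType) (C : gcomplex G).

Lemma bicoboundaryB (F F' : bicochain P A C) p q x y :
  bicoboundary (fun p q x y => F p q x y - F' p q x y) (p := p) (q := q) x y =
  bicoboundary F x y - bicoboundary F' x y.
Proof.
rewrite /bicoboundary opprD addrACA -mulrzBl; congr (_ + _).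
  by case: p x => [|p] x //; rewrite subrr.
by case: q y => [|q] y //; rewrite subrr.
Qed.

Lemma is_bicochainB (F F' : bicochain P A C) :
  is_bicochain F -> is_bicochain F' ->
  is_bicochain (fun p q x y => F p q x y - F' p q x y).
Proof.
move=> FP F'P p q; have [Fl Fr Fg] := FP p q; have [F'l F'r F'g] := F'P p q.
split=> [y x x'|x y y'|g x y]; last by rewrite Fg F'g.
  by rewrite Fl F'l !opprD addrACA.
by rewrite Fr F'r !opprD addrACA.
Qed.

Lemma bicohomologous_subr k (F1 F2 F : bicochain P A C) :
  bicohomologous k F1 F -> bicohomologous k F2 F -> bicohomologous k F1 F2.
Proof.
move=> [B1 B1P dB1] [B2 B2P dB2].
exists (fun p q x y => B1 p q x y - B2 p q x y); first exact: is_bicochainB.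
by move=> p q pq x y; rewrite bicoboundaryB -dB1 // -dB2 // opprB addrA subrK.
Qed.

Variable eps : {additive C 0%N -> int}.

(** A coboundary [a o d] pulls back to the coboundary of [a (x) eps], because
    [eps o d = 0]. *)
Lemma const_pullback_coboundary (f f' : P 2%N -> A) (F : bicochain P A C) :
  (forall g y, eps (gact g y) = eps y) -> (forall y, eps (bd y) = 0) ->
  group_class f f' -> bicohomologous 2%N (const_pullback eps f) F ->
  bicohomologous 2%N (const_pullback eps f') F.
Proof.
move=> eps_inv eps_bd [a [aB a_inv] f'E] [B BP dB].
pose Ba : bicochain P A C := fun p q =>
  match p, q return P p -> C q -> A with
  | 1%N, 0%N => fun x y => - (a x *~ eps y) | _, _ => fun _ _ => 0 end.
exists (fun p q x y => B p q x y - Ba p q x y).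
  apply: is_bicochainB => // p q; case: p => [|[|p]]; case: q => [|q];
    rewrite /Ba; try (by split=> ? ? ?; rewrite ?subrr).
  split=> [y x x0|x y y0|g x y]; last by rewrite a_inv eps_inv.
    by rewrite aB mulrzBl opprB opprK addrC.
  by rewrite raddfB mulrzBr opprB opprK addrC.
move=> p q pq x y; rewrite bicoboundaryB -dB // /bicoboundary.
case: p q pq x y => [|[|[|p]]] [|[|[|q]]] //= _ x y;
  rewrite ?eps_bd ?mul0rz ?addr0 ?subr0 ?opprK ?mulr0z ?oppr0 ?mul0rz ?addr0 ?subr0//.
by rewrite f'E mulrzDl addrAC.
Qed.

(** If [B] bounds the pull-back of [f' - f], its component on [P_0 x C_1]
    vanishes on boundaries of [C_1], hence on cycles. So it is a map from [P_0]
    to [Hom(im d, A)]. Restriction [Hom(C_0, A) -> Hom(im d, A)] is onto, since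
    [im d = ker eps] is a direct summand of [C_0]; projectivity of [P_0] lifts
    the map to an equivariant [ext : P_0 -> Hom(C_0, A)]. Subtracting the
    coboundary of [ext] from [B] leaves a component on [P_1 x C_0] that factors
    through [eps], that is [a (x) eps] with [f' = f + a o d]. *)
Theorem const_pullback_inj (y0 : C 0%N) (f f' : P 2%N -> A) :
  eps y0 = 1 -> (forall g y, eps (gact g y) = eps y) ->
  (forall y, eps (bd y) = 0) ->
  (forall y, eps y = 0 -> exists z : C 1%N, bd z = y) ->
  (forall z : C 1%N, bd z = 0 -> exists w : C 2%N, bd w = z) ->
  bicohomologous 2%N (const_pullback eps f') (const_pullback eps f) ->
  group_class f f'.
Proof.
move=> eps_y0 eps_inv eps_bd exact0 exact1 [B BP dB].
pose cycle (z : C 1%N) := bd z = 0 :> C 0%N.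
have cycle_stable g z : cycle z -> cycle (gact g z).
  move=> z0; rewrite /cycle bd_equivariant z0.
  by have := gact_zmod_morphism g (0 : C 0%N) 0; rewrite !subrr.
pose M := hom_gmod A (fun (g : G) (z : C 0%N) (z_false : False) => z_false).
pose N := hom_gmod A cycle_stable.
have bd_star_subproof (psi : M) : (fun z => psi (bd z)) \in vanishing_hom_pred cycle.
  have [psiB _] := vanishing_homP psi.
  by apply/asboolP; split=> [z z'|z ->]; rewrite ?raddfB ?psiB // -(subrr 0) psiB subrr.
pose bd_star (psi : M) : N := VanishingHom (bd_star_subproof psi).
have bd_starB : zmod_morphism bd_star by move=> psi psi'; apply: val_inj.
have B01_subproof (x : P 0%N) : B 0%N 1%N x \in vanishing_hom_pred cycle.
  have [_ Br _] := BP 0%N 1%N; apply/asboolP; split=> // z /exact1[w <-].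
  by have := dB 0%N 2%N erefl x w; rewrite /bicoboundary /= subrr add0r expr0.
pose B01 (x : P 0%N) : N := VanishingHom (B01_subproof x).
have B01B : zmod_morphism B01.
  move=> x x'; apply/val_inj/funext => z; have [Bl _ _] := BP 0%N 1%N.
  exact: Bl.
pose bd_star_add : {additive M -> N} :=
  HB.pack bd_star (GRing.isZmodMorphism.Build _ _ bd_star bd_starB).
pose B01_add : {additive P 0%N -> N} :=
  HB.pack B01 (GRing.isZmodMorphism.Build _ _ B01 B01B).
have [|||ext [ext_equiv extE]] := @res_projective _ P 0%N M N bd_star_add B01_add.
- by move=> g psi; apply/val_inj/funext => z /=; rewrite bd_equivariant.
- move=> g x; apply/val_inj/funext => z /=; have [_ _ Bg] := BP 0%N 1%N.
  by rewrite -[z in LHS](gact1 z) -(mulgV g) gactM Bg.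
- move=> phi; have [phiB phi0] := vanishing_homP phi.
  have phi_bd z z' : bd z = bd z' -> phi z = phi z'.
    by move=> zz'; apply/eqP; rewrite -subr_eq0 -phiB phi0 // /cycle raddfB zz' subrr.
  (* A section of d on ker eps; [phi] does not see its failure of additivity. *)
  have /choice[sec secP] y : exists z : C 1%N, eps y = 0 -> bd z = y.
    by have [/exact0[z]|] := pselect (eps y = 0); [exists z | exists 0].
  pose proj y := y - y0 *~ eps y.
  have secK y : bd (sec (proj y)) = proj y.
    by apply: secP; rewrite raddfB raddfMz /= eps_y0 intz subrr.
  have psi_subproof : (fun y => phi (sec (proj y))) \in 
      vanishing_hom_pred (fun _ : C 0%N => False).
    apply/asboolP; split=> // y y'; rewrite -phiB; apply: phi_bd.
    by rewrite raddfB !secK /proj raddfB mulrzBr !opprD addrACA.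
  exists (VanishingHom psi_subproof); apply/val_inj/funext => z /=.
  by apply: phi_bd; rewrite secK /proj eps_bd mulr0z subr0.
have extB x : zmod_morphism (ext x) by have [] := vanishing_homP (ext x).
have ext_bd x z : ext x (bd z) = B 0%N 1%N x z.
  exact: (congr1 (fun phi : N => phi z) (extE x)).
have [B10l B10r B10g] := BP 1%N 0%N.
have B10_bd x z : B 1%N 0%N x (bd z) = ext (bd x) (bd z).
  have /esym := dB 1%N 1%N erefl x z; rewrite /bicoboundary /= subrr expr1 ext_bd.
  by move/eqP; rewrite mulrN1z subr_eq0 => /eqP.
(* After subtraction of [ext o d], the rest of [B 1 0] factors through [eps]. *)
pose a x := B 1%N 0%N x y0 - ext (bd x) y0.
have B10E x y : B 1%N 0%N x y = ext (bd x) y + a x *~ eps y.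
  have /exact0[z zE] : eps (y - y0 *~ eps y) = 0.
    by rewrite raddfB raddfMz /= eps_y0 intz subrr.
  pose r y := B 1%N 0%N x y - ext (bd x) y.
  have rB : zmod_morphism r.
    by move=> u u'; rewrite /r B10r extB !opprD addrACA.
  pose r_add : {additive C 0%N -> A} := HB.pack r (GRing.isZmodMorphism.Build _ _ r rB).
  have /eqP : r_add (y - y0 *~ eps y) = 0 by rewrite -zE /= /r B10_bd subrr.
  rewrite raddfB raddfMz subr_eq0 => /eqP /= rE.
  by rewrite -[a x]/(r y0) -rE addrC subrK.
exists a; first split.
- move=> x x'; have extBd : ext (bd (x - x')) y0 = ext (bd x) y0 - ext (bd x') y0.
    by rewrite !raddfB.
  by rewrite /a B10l extBd !opprD addrACA.
- move=> g x; have gK : y0 = gact g (gact g^-1%g y0) by rewrite -gactM mulgV gact1.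
  rewrite /a {1}gK B10g bd_equivariant ext_equiv /= B10E eps_inv eps_y0.
  by rewrite mulr1z addrAC subrr add0r.
- move=> x.
  have ext0 : ext (bd (bd x)) y0 = 0 by rewrite bdK raddf0.
  have := dB 2%N 0%N erefl x y0; rewrite /bicoboundary /= eps_y0 !mulr1z B10E ext0.
  rewrite eps_y0 mulr1z add0r addr0 => <-.
  by rewrite addrC subrK.
Qed.
End GroupHypercohomology.

(** * Acyclicity of flag complexes by coning *)

Section Cone.
Variables (G : groupType) (T : ggraph G) (w : T).

Definition coned k (s : flag_simplex T k) := [forall j, adj w (s j)].

Definition cone_vertices k (s : flag_simplex T k) : {ffun 'I_k.+2 -> T} :=
  [ffun j => oapp s w (unlift ord0 j)].

(** The cone with apex [w]; the default 0 is used on simplices that have a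
    vertex which is not a neighbour of [w]. *)
Definition cone k (s : flag_simplex T k) : {freeg (flag_simplex T k.+1)} :=
  oapp (fun t => << t >>) 0 (insub (cone_vertices s)).

Fact cone_subproof k (s : flag_simplex T k) :
  coned s -> pairwise_eq_adj (cone_vertices s).
Proof.
move=> /forallP ws; apply/forallP => a; apply/forallP => b; rewrite !ffunE.
case: unliftP => [i _|_]; case: unliftP => [j _|_] /=; rewrite ?eqxx //.
- by have /forallP/(_ i)/forallP := valP s; apply.
- by rewrite adj_sym ws orbT.
- by rewrite ws orbT.
Qed.

Definition cone_simplex k (s : flag_simplex T k) ws := FlagSimplex (@cone_subproof k s ws).

Lemma coneE k (s : flag_simplex T k) (ws : coned s) : cone s = << cone_simplex ws >>.
Proof.
rewrite /cone; case: insubP => [t _ tE|/negP[]] /=; last exact: cone_subproof.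
by congr << _ >>; apply: val_inj.
Qed.

Lemma face0_cone k (s : flag_simplex T k) (ws : coned s) :
  face ord0 (cone_simplex ws) = s.
Proof. by apply/val_inj/ffunP => j; rewrite !ffunE liftK. Qed.

Lemma coned_face k (i : 'I_k.+2) (s : flag_simplex T k.+1) : coned s -> coned (face i s).
Proof. by move=> /forallP ws; apply/forallP => j; rewrite ffunE. Qed.

Lemma face_cone k (i : 'I_k.+2) (s : flag_simplex T k.+1) (ws : coned s) :
  face (lift ord0 i) (cone_simplex ws) = cone_simplex (coned_face i ws).
Proof.
apply/val_inj/ffunP => j; rewrite !ffunE.
case: (unliftP ord0 j) => [j'|] -> /=.
  have -> : lift (lift ord0 i) (lift ord0 j') = lift ord0 (lift i j').
    by apply: val_inj; rewrite /= /bump !leq0n !add1n ltnS addnS.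
  by rewrite liftK /= ffunE.
have -> : lift (lift ord0 i) ord0 = ord0 by apply: val_inj.
by rewrite unlift_none.
Qed.

Definition cone_chain k : {freeg (flag_simplex T k)} -> {freeg (flag_simplex T k.+1)} :=
  zextend (@cone k).

HB.instance Definition _ k := GRing.Additive.on (@cone_chain k).

(** Face 0 of the cone removes the apex, and the other faces are cones over the
    faces; so coning is a contracting homotopy on chains of neighbours. *)
Lemma flag_bd_cone k (s : flag_simplex T k.+1) : coned s ->
  flag_bd (cone_chain << s >>) = << s >> - cone_chain (@flag_bd _ T k << s >>).
Proof.
move=> ws; rewrite /cone_chain !zextendU (coneE ws) /flag_bd !zextendU.
rewrite big_ord_recl face0_cone expr0.
congr (_ + _); rewrite raddf_sum -sumrN; apply: eq_bigr => i _.
rewrite face_cone raddfMz /= zextendU (coneE (coned_face i ws)) -mulrNz.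
by rewrite /= /bump leq0n exprS mulN1r.
Qed.

Definition point_simplex : flag_simplex T 0%N.
Proof.
exists [ffun _ => w].
abstract (by apply/forallP => i; apply/forallP => j; rewrite !ffunE eqxx).
Defined.

Lemma flag_bd_cone0 (s : flag_simplex T 0%N) : coned s ->
  flag_bd (cone_chain << s >>) = << s >> - << point_simplex >>.
Proof.
move=> ws; rewrite /cone_chain !zextendU (coneE ws) /flag_bd !zextendU.
rewrite big_ord_recl face0_cone expr0.
rewrite big_ord1 expr1; congr (_ + _); rewrite mulrN1z; congr (- << _ >>).
apply/val_inj/ffunP => j; rewrite !ffunE.
have -> : lift (lift ord0 ord0) j = ord0 by rewrite (ord1 j); apply: val_inj.
by rewrite unlift_none.
Qed.

End Cone.

Section FlagAcyclic.
Variables (G : groupType) (T : ggraph G).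
Hypothesis common_neighbour : forall s : seq T, exists w, all (adj w) s.

(** A chain involves finitely many vertices, so a single apex serves it all. *)
Lemma common_cone k (c : {freeg (flag_simplex T k)}) :
  exists w, forall s, s \in dom c -> coned w s.
Proof.
have [w /allP ws] := common_neighbour
  (flatten [seq codom (s : flag_simplex T k) | s <- dom c]).
exists w => s sc; apply/forallP => j; apply: ws; apply/flattenP.
by exists (codom s); [apply: map_f | apply: codom_f].
Qed.

Lemma flag_exactS k (c : flag_complex T k.+1) :
  bd c = 0 -> exists b : flag_complex T k.+2, bd b = c.
Proof.
move=> c0; have [w wc] := common_cone c; exists (cone_chain w c).
have := @freeg_ext_in _ _ (@flag_bd _ T k.+1 \o cone_chain w (k:=k.+1))
  (idfun \- (cone_chain w (k:=k) \o @flag_bd _ T k)) c.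
move=> /(_ (fun s sc => flag_bd_cone (wc s sc))) /= E.
by rewrite [LHS]E c0 raddf0 subr0.
Qed.

Lemma flag_augU (s : flag_simplex T 0%N) : flag_aug (<< s >> : flag_complex T 0%N) = 1.
Proof. exact: degU. Qed.

HB.instance Definition _ := GRing.Additive.copy (@flag_aug G T) (@deg _).

Lemma flag_exact0 (c : flag_complex T 0%N) :
  flag_aug c = 0 -> exists b : flag_complex T 1%N, bd b = c.
Proof.
move=> c0; have [w wc] := common_cone c; exists (cone_chain w (k:=0%N) c).
have := @freeg_ext_in _ _ (@flag_bd _ T 0%N \o cone_chain w (k:=0%N))
  (idfun \- zextend (fun=> << point_simplex w >>)) c.
move=> /= E; rewrite [LHS]E; first by rewrite zextend_cst -/(flag_aug c) c0 mulr0z subr0.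
by move=> s sc; rewrite zextendU flag_bd_cone0 ?wc.
Qed.

Lemma flag_aug_bd (c : flag_complex T 1%N) : flag_aug (bd c : flag_complex T 0%N) = 0.
Proof.
apply: (freeg_morph_ext (f := deg (K:=_) \o @flag_bd _ T 0%N) (g := \0)) => s /=.
by rewrite /flag_bd zextendU big_ord_recl big_ord1 raddfD !raddfMz /= !degU.
Qed.

Lemma flag_aug_act g (c : flag_complex T 0%N) : flag_aug (gact g c) = flag_aug c.
Proof.
apply: (freeg_morph_ext (f := deg (K:=_) \o zextend _) (g := deg (K:=_))) => s /=.
by rewrite zextendU !degU.
Qed.

End FlagAcyclic.

(** * Comparing an orbit cocycle with its restriction to a flag complex *)

(** Normalises the indices and signs produced by expanding a boundary. *)
Definition alternating_signs := (addn0, add0n, add1n,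
  (@exprS int, @expr0 int, @mulr1 int, @mulrN1 int, @opprK int),
  @mulrN1z, @mulr1z).

Section Corner.
Variables (G : groupType) (T : ggraph G).

(** Indexing vertices by naturals makes the vertices of a face computable. *)
Definition corner k (s : flag_simplex T k) (j : nat) : T := s (inord j).

Lemma cornerE k (s : flag_simplex T k) j : s j = corner s j.
Proof. by rewrite /corner inord_val. Qed.

Lemma corner_face k (i : 'I_k.+2) (s : flag_simplex T k.+1) j :
  (j < k.+1)%N -> corner (face i s) j = corner s (bump i j).
Proof.
move=> jk; rewrite /corner ffunE; congr (s _); apply: val_inj => /=.
have j1 : (bump i j < k.+2)%N 
  by apply: (@leq_ltn_trans (1 + j)%N) => //; rewrite leq_add2r leq_b1.
by rewrite !inordK.
Qed.

Lemma corner_act k g (s : flag_simplex T k) j :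
  corner (simplex_act g s) j = vact g (corner s j).
Proof. by rewrite /corner ffunE. Qed.

End Corner.

Section OrbitCocycle.
Variables (G : groupType) (T : ggraph G) (A : zmodType) (P : gresolution G).
Variables (phi : bar_comparison P) (K : T -> T -> T -> A) (X0 : T).
Hypothesis K_inv : forall g x y z, K (vact g x) (vact g y) (vact g z) = K x y z.
Hypothesis K_cocycle : forall x y z t, K y z t - K x z t + K x y t - K x y z = 0.

Lemma K_face3 x y z t : K x y z = K y z t - K x z t + K x y t.
Proof. by apply/eqP; rewrite eq_sym -subr_eq0 K_cocycle. Qed.

Lemma K_face0 x y z t : K y z t = K x z t - K x y t + K x y z.
Proof. by rewrite (K_face3 x y z t) [RHS]addrC addrACA subrK subrr addr0. Qed.

Local Notation C := (flag_complex T).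
Local Notation bar := (complete_graph G).

Definition orbit_corner k (s : flag_simplex bar k) j := vact (corner s j : G) X0.
Definition flag_cochain : {freeg (flag_simplex T 2%N)} -> A :=
  zextend (fun s => K (corner s 0) (corner s 1) (corner s 2)).
HB.instance Definition _ := GRing.Additive.on flag_cochain.
Definition bar_cochain : {freeg (flag_simplex bar 2%N)} -> A :=
  zextend (fun s => K (orbit_corner s 0) (orbit_corner s 1) (orbit_corner s 2)).
HB.instance Definition _ := GRing.Additive.on bar_cochain.

Definition orbit_cocycle g g' := K X0 (vact g X0) (vact (g * g')%g X0).

Lemma of_inhomogeneous_orbit x :
  of_inhomogeneous phi orbit_cocycle x = bar_cochain (phi 2%N x).
Proof.
rewrite /of_inhomogeneous /bar_cochain; congr (zextend _ _); apply/funext => s.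
rewrite !(cornerE s) /= inordK // -[RHS](K_inv ((corner s 0 : G)^-1)%g) /orbit_cocycle.
by rewrite mulgA mulgK /orbit_corner -!vactM mulVg vact1.
Qed.

Lemma orbit_cornerJ k g (s : flag_simplex bar k) j :
  orbit_corner (simplex_act g s) j = vact g (orbit_corner s j).
Proof. by rewrite /orbit_corner corner_act vactM. Qed.

Lemma is_group_cocycle_orbit : is_group_cocycle (of_inhomogeneous phi orbit_cocycle).
Proof.
split; first split.
- by move=> x y; rewrite !of_inhomogeneous_orbit !raddfB.
- move=> g x; rewrite !of_inhomogeneous_orbit to_bar_equivariant.
  apply: (freeg_morph_ext (f := bar_cochain \o zextend _) (g := bar_cochain)) => s /=.
  by rewrite /bar_cochain !zextendU !orbit_cornerJ K_inv.
- move=> x; rewrite !of_inhomogeneous_orbit to_bar_bd.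
  apply: (freeg_morph_ext (f := bar_cochain \o @flag_bd _ bar 2) (g := \0)) => s /=.
  rewrite /flag_bd zextendU !big_ord_recl big_ord0 addr0 !raddfD !raddfMz /=.
  rewrite /bar_cochain !zextendU /orbit_corner !corner_face //.
  by rewrite !alternating_signs !addrA K_cocycle.
Qed.

(** [K] on the mixed triples formed by an orbit simplex followed by a flag
    simplex, up to sign; these are the two blocks of the prism between the orbit map
    and the inclusion of the flag complex into the complex of all tuples. *)
Definition orbit_homotopy : bicochain P A C := fun p q =>
  match p, q return P p -> C q -> A with
  | 1%N, 0%N => fun x y =>
      biextend (fun s t => K (orbit_corner s 0) (orbit_corner s 1) (corner t 0)) (phi 1%N x) y
  | 0%N, 1%N => fun x y =>
      - biextend (fun s t => K (orbit_corner s 0) (corner t 0) (corner t 1)) (phi 0%N x) y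
  | _, _ => fun _ _ => 0
  end.

Lemma biextend_bar_act p q (c : flag_simplex bar p -> flag_simplex T q -> A) g x y :
  (forall s t, c (simplex_act g s) (simplex_act g t) = c s t) ->
  biextend c (gact g x : bar_complex G p) (gact g y : C q) = biextend c x y.
Proof.
move=> c_inv; move: x y; apply: freeg_biadditive_ext.
- by move=> y x x'; rewrite gact_zmod_morphism; apply: biextend_morphl.
- by move=> x y y'; rewrite gact_zmod_morphism; apply: biextend_morphr.
- exact: biextend_morphl.
- exact: biextend_morphr.
by move=> s t; rewrite /= !zextendU !biextendU !zextendU c_inv.
Qed.

Lemma orbit_homotopy_is_bicochain : is_bicochain orbit_homotopy.
Proof.
move=> p q; case: p => [|[|p]]; case: q => [|[|q]]; rewrite /orbit_homotopy;
  try (by split=> ? ? ?; rewrite ?subrr).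
- split=> [y x x'|x y y'|g x y].
  + by rewrite raddfB biextend_morphl opprD.
  + by rewrite biextend_morphr opprD.
  + rewrite to_bar_equivariant biextend_bar_act // => s t.
    by rewrite orbit_cornerJ !corner_act K_inv.
- split=> [y x x'|x y y'|g x y].
  + by rewrite raddfB biextend_morphl.
  + by rewrite biextend_morphr.
  + rewrite to_bar_equivariant biextend_bar_act // => s t.
    by rewrite !orbit_cornerJ !corner_act K_inv.
Qed.

(** Each of the three components of the equation is the cocycle identity of [K]
    for a quadruple with one, two or three entries in the orbit. *)
Theorem orbit_class :
  bicohomologous 2%N (const_pullback (@flag_aug _ T) (of_inhomogeneous phi orbit_cocycle))
                     (of_invariant (flag_cochain : C 2%N -> A)).
Proof.
exists orbit_homotopy; first exact: orbit_homotopy_is_bicochain.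
move=> p q pq; case: p pq => [|[|[|p]]]; case: q => [|[|[|q]]] //= _ x y;
  rewrite /bicoboundary /= ?subr0 ?sub0r ?addr0 ?add0r ?mul0rz ?addr0.
- congr (- _); rewrite -(to_bar_aug phi).
  move: (phi 0%N x) y; apply: freeg_biadditive_ext.
  + by move=> y u v; rewrite /flag_aug raddfB mulrzBr.
  + by move=> u y y'; rewrite raddfB mulrzBl.
  + by move=> y; apply: biextend_morphl.
  + by move=> u y y'; rewrite /flag_bd raddfB; apply: biextend_morphr.
  move=> s t; rewrite /flag_aug degU mulr1z biextendU /flag_bd /flag_cochain !zextendU.
  rewrite !big_ord_recl big_ord0 addr0 !raddfD !raddfMz /= !zextendU !corner_face //.
  rewrite /bump /= !alternating_signs !addrA.
  exact: K_face0.
- rewrite expr1 mulrN1z to_bar_bd; apply/esym/eqP; rewrite subr_eq0; apply/eqP.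
  move: (phi 1%N x) y; apply: freeg_biadditive_ext.
  + by move=> y u v; rewrite raddfB biextend_morphl opprD.
  + by move=> u y y'; rewrite biextend_morphr opprD.
  + by move=> y; apply: biextend_morphl.
  + by move=> u y y'; rewrite /flag_bd raddfB; apply: biextend_morphr.
  move=> s t; rewrite /= /flag_bd !zextendU !big_ord_recl !big_ord0 !addr0.
  rewrite /biextend !raddfD !raddfMz /= !zextendU /orbit_corner.
  rewrite !raddfD !raddfMz /= !zextendU !corner_face //.
  rewrite /bump /= !alternating_signs.
  by rewrite (K_face3 _ _ (corner t 0) (corner t 1)) opprD addrCA subrr addr0 opprD.
- rewrite of_inhomogeneous_orbit to_bar_bd.
  move: (phi 2%N x) y; apply: freeg_biadditive_ext.
  + by move=> y u v; rewrite raddfB mulrzBl.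
  + by move=> u y y'; rewrite /flag_aug raddfB mulrzBr.
  + by move=> y u v; rewrite !raddfB; apply: biextend_morphl.
  + by move=> u y y'; apply: biextend_morphr.
  move=> s t; rewrite /flag_aug degU mulr1z /= /flag_bd /bar_cochain !zextendU.
  rewrite !big_ord_recl big_ord0 addr0 /biextend !raddfD !raddfMz /= !zextendU.
  rewrite /orbit_corner !corner_face // /bump /= !alternating_signs !addrA.
  exact: K_face3.
Qed.
End OrbitCocycle.

(** * Witt classes of symmetric matrices *)

Section WittClass.
Variable D : fieldType.

Lemma witt_relator_eq0 r : witt_relator (D := D) r -> \pi_(witt D)%qT r = 0.
Proof.
move=> rel; have rnull : r - 0 \in @witt_null D.
  by rewrite subr0; apply/asboolP => S _; apply.
by move: rnull; rewrite Quotient.idealrBE => /eqP ->; rewrite raddf0.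
Qed.

Lemma witt_class_isometry k (t t' : nsform D k) (g : 'M_k) :
  g \in unitmx -> t = g^T *m t' *m g :> 'M_k -> witt_class t = witt_class t'.
Proof.
move=> gU tE; apply/eqP; rewrite -subr_eq0 -raddfB; apply/eqP.
exact/witt_relator_eq0/(WittIsometry gU tE).
Qed.

Lemma witt_class_sum k l (t : nsform D k) (u : nsform D l) (v : nsform D (k + l)) :
  v = block_mx t 0 0 u :> 'M_(k + l) -> witt_class v = witt_class t + witt_class u.
Proof.
move=> vE; apply/eqP; rewrite -subr_eq0 -raddfD -raddfB; apply/eqP.
exact/witt_relator_eq0/(WittSum vE).
Qed.

Lemma witt_class_hyperbolic k (t : nsform D (k + k)) :
  t = block_mx 0 1%:M 1%:M 0 :> 'M_(k + k) -> witt_class t = 0.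
Proof. by move=> tE; apply/witt_relator_eq0/(WittHyperbolic tE). Qed.

Lemma nsform_sym k (t : nsform D k) : t^T = t.
Proof. by have /andP[/eqP] := valP t. Qed.

Lemma nsform_unit k (t : nsform D k) : (t : 'M_k) \in unitmx.
Proof. by have /andP[] := valP t. Qed.

Lemma nsform_rank k (t : nsform D k) : \rank t = k.
Proof. exact/mxrank_unit/nsform_unit. Qed.

(** The two sizes are only propositionally equal in the applications, where one
    of them is a rank. *)
Lemma witt_class_congr_eq k m (t : nsform D k) (u : nsform D m) (g : 'M_(k, m)) :
  k = m -> t = g *m u *m g^T :> 'M_k -> witt_class t = witt_class u.
Proof.
move=> km; case: m / km u g => u g tE; apply: (@witt_class_isometry _ _ _ g^T).
  by have := nsform_unit t; rewrite tE unitmx_mul => /andP[].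
by rewrite trmxK.
Qed.

(** A total function on square matrices, so that classes can be rewritten
    without carrying symmetry proofs; the value 0 at other
    matrices is a dummy. *)
Definition witt_of k (S : 'M[D]_k) : witt D :=
  if pselect (S^T = S) is left S_sym then witt_class (nondeg_part S_sym) else 0.

Lemma witt_ofE k (S : 'M[D]_k) (S_sym : S^T = S) :
  witt_of S = witt_class (nondeg_part S_sym).
Proof.
rewrite /witt_of; case: pselect => // S_sym'.
by congr witt_class; apply: val_inj.
Qed.

Lemma rank_radical_compl k (S : 'M[D]_k) : \rank (kermx S)^C%MS = \rank S.
Proof. by rewrite mxrank_compl mxrank_ker subKn ?rank_leq_row. Qed.

(** Modulo the radical of [S], the rows of [g] are combinations, with matrix [e],
    of the chosen basis of a complement. *)
Lemma witt_of_nsform_congr k m (t : nsform D k) (S : 'M_m) (g : 'M_(k, m)) :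
  S^T = S -> t = g *m S *m g^T :> 'M_k -> \rank S = k -> witt_class t = witt_of S.
Proof.
move=> S_sym tE rS; rewrite (witt_ofE S_sym).
have : (g <= kermx S + radical_compl S)%MS.
  apply: (submx_trans (submx_full _ (addsmx_compl_full (kermx S)))).
  by rewrite addsmxS // eq_row_base.
case/sub_addsmxP => -[a e] /= gE; set B := radical_compl S in gE.
apply: (@witt_class_congr_eq _ _ _ _ e); first by rewrite rank_radical_compl.
have KS : kermx S *m S = 0 := mulmx_ker S.
have SK : S *m (kermx S)^T = 0 by rewrite -{1}S_sym -trmx_mul KS trmx0.
have gS : g *m S = e *m B *m S by rewrite gE mulmxDl -mulmxA KS mulmx0 add0r.
rewrite tE gS -!mulmxA.
have -> : S *m g^T = S *m (e *m B)^T.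
  by rewrite gE linearD /= trmx_mul mulmxDr mulmxA SK mul0mx add0r.
by rewrite trmx_mul /= /nondeg_mx -/B !mulmxA.
Qed.

Lemma witt_of_nsform k (t : nsform D k) : witt_of t = witt_class t.
Proof.
by apply/esym/(@witt_of_nsform_congr _ _ _ _ 1%:M);
  rewrite ?nsform_sym ?nsform_rank ?trmx1 ?mul1mx ?mulmx1.
Qed.

(** [g] may be rectangular: this compares forms on spaces of different
    dimensions with isometric nondegenerate parts. *)
Lemma witt_of_congr k m (S : 'M[D]_k) (S' : 'M_m) (g : 'M_(k, m)) :
  S^T = S -> S'^T = S' -> S = g *m S' *m g^T -> \rank S = \rank S' ->
  witt_of S = witt_of S'.
Proof.
move=> S_sym S'_sym SE rSS'; rewrite (witt_ofE S_sym).
have congrS p (B : 'M_(p, k)) : B *m S *m B^T = B *m g *m S' *m (B *m g)^T.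
  by rewrite SE trmx_mul !mulmxA.
apply: (@witt_of_nsform_congr _ _ _ _ (radical_compl S *m g)) => //.
  exact: congrS.
by rewrite -rSS' rank_radical_compl.
Qed.

Lemma witt_of_congr_unit k (S S' : 'M[D]_k) (g : 'M_k) :
  S'^T = S' -> g \in unitmx -> S = g *m S' *m g^T -> witt_of S = witt_of S'.
Proof.
move=> S'_sym gU SE; apply: (witt_of_congr _ S'_sym SE).
  by rewrite SE !trmx_mul trmxK S'_sym mulmxA.
rewrite SE mxrankMfree ?row_free_unit ?unitmx_tr // -mxrank_tr trmx_mul.
by rewrite mxrankMfree ?row_free_unit ?unitmx_tr // mxrank_tr.
Qed.

Lemma witt_of_sum k l (S : 'M[D]_k) (S' : 'M_l) :
  S^T = S -> S'^T = S' -> witt_of (block_mx S 0 0 S') = witt_of S + witt_of S'.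
Proof.
move=> S_sym S'_sym; rewrite (witt_ofE S_sym) (witt_ofE S'_sym).
have SS'_sym : (block_mx S 0 0 S')^T = block_mx S 0 0 S'.
  by rewrite tr_block_mx S_sym S'_sym !trmx0.
set t := nondeg_part S_sym; set u := nondeg_part S'_sym.
have v_subproof : ((block_mx t 0 0 u)^T == block_mx t 0 0 u) &&
    (block_mx t 0 0 u \in unitmx).
  rewrite tr_block_mx !trmx0 !nsform_sym eqxx unitmxE det_ublock unitrM.
  by rewrite -!unitmxE !nsform_unit.
rewrite -(@witt_class_sum _ _ t u (NSForm v_subproof)) //; apply/esym.
apply: (@witt_of_nsform_congr _ _ _ _
  (block_mx (radical_compl S) 0 0 (radical_compl S'))) => //=.
  by rewrite tr_block_mx !mulmx_block !trmx0 !(mul0mx, mulmx0, addr0, add0r).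
by rewrite rank_diag_block_mx !rank_radical_compl.
Qed.

Lemma witt_of0 k : witt_of (0 : 'M[D]_k) = 0.
Proof.
have v_subproof : ((0 : 'M[D]_(0 + 0))^T == 0) && ((0 : 'M[D]_(0 + 0)) \in unitmx).
  by rewrite trmx0 eqxx unitmxE det_mx00 unitr1.
rewrite -(@witt_class_hyperbolic 0 (NSForm v_subproof)); last by apply/matrixP => -[].
apply/esym/(@witt_of_nsform_congr _ _ _ _ 0); rewrite ?trmx0 ?mxrank0 //.
by apply/matrixP => -[].
Qed.

Hypothesis D_char : 2%N \notin [pchar D].

Lemma two_neq0 : 2%:R != 0 :> D.
Proof. by move: D_char; rewrite inE /=. Qed.

Lemma antidiag_unit k (a : D) : a != 0 ->
  (block_mx 0 a%:M a%:M 0 : 'M[D]_(k + k)) \in unitmx.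
Proof.
move=> a0; have /mulmx1_unit[] // :
  (block_mx 0 a%:M a%:M 0 : 'M[D]_(k + k)) *m block_mx 0 a^-1%:M a^-1%:M 0 = 1%:M.
by rewrite mulmx_block !(mul0mx, mulmx0, addr0, add0r) -scalar_mxM mulfV // -scalar_mx_block.
Qed.

Lemma witt_of_antidiag k (N : 'M[D]_k) :
  N^T = N -> N \in unitmx -> witt_of (block_mx 0 N N 0) = 0.
Proof.
move=> N_sym NU; set S := block_mx _ _ _ _.
have v_subproof : ((block_mx 0 1%:M 1%:M 0 : 'M[D]_(k + k))^T == block_mx 0 1%:M 1%:M 0) &&
    ((block_mx 0 1%:M 1%:M 0 : 'M[D]_(k + k)) \in unitmx).
  by rewrite tr_block_mx !trmx0 !trmx1 eqxx antidiag_unit ?oner_eq0.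
rewrite -(@witt_class_hyperbolic k (NSForm v_subproof)) // -witt_of_nsform.
apply: (@witt_of_congr_unit _ _ _ (block_mx N 0 0 1%:M)); rewrite ?nsform_sym //.
  by rewrite unitmxE det_ublock det1 mulr1 -unitmxE.
rewrite tr_block_mx !trmx0 !mulmx_block N_sym trmx1 /=.
by rewrite !(mul0mx, mulmx0, addr0, add0r, mul1mx, mulmx1).
Qed.

(** The diagonal and the antidiagonal are complementary isotropic subspaces. *)
Lemma witt_of_opp_nondeg k (N : 'M[D]_k) :
  N^T = N -> N \in unitmx -> witt_of (block_mx N 0 0 (- N)) = 0.
Proof.
move=> N_sym NU; rewrite -(witt_of_antidiag N_sym NU); apply/esym.
pose h : D := 2%:R^-1.
have hh : h + h = 1 by rewrite -mulr2n -(mulr_natr h) mulVf ?two_neq0.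
apply: (@witt_of_congr_unit _ _ _ (block_mx 1%:M 1%:M h%:M (- h)%:M)).
- by rewrite tr_block_mx !trmx0 linearN /= N_sym.
- have /mulmx1_unit[] // : block_mx 1%:M 1%:M h%:M (- h)%:M *m
     block_mx h%:M 1%:M h%:M (- 1)%:M = 1%:M :> 'M[D]_(k + k).
  rewrite mulmx_block !mul1mx -!raddfD /= hh subrr -!scalar_mxM -!raddfD /=.
  by rewrite mulr1 mulrNN mulr1 hh mulNr subrr raddf0 -scalar_mx_block.
rewrite tr_block_mx !mulmx_block !tr_scalar_mx /=.
rewrite !(mul0mx, mulmx0, addr0, add0r, mul1mx, mulmx1) !mul_scalar_mx !mul_mx_scalar.
rewrite subrr !scaleNr !scalerN !opprK -!scalerDl hh !scale1r.
by rewrite subrr.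
Qed.

Lemma witt_ofN k (S : 'M[D]_k) : S^T = S -> witt_of (- S) = - witt_of S.
Proof.
move=> S_sym; rewrite [in RHS](witt_ofE S_sym).
set N := nondeg_part S_sym; have NN_sym : (- (N : 'M_ _))^T = - (N : 'M_ _).
  by rewrite linearN; congr (- _); exact: nsform_sym.
have <- : witt_of (- (N : 'M_ _)) = witt_of (- S).
  apply: (@witt_of_congr _ _ _ _ (radical_compl S)) => //.
  - by rewrite linearN /= S_sym.
  - by rewrite mulmxN mulNmx.
  - by rewrite !mxrank_opp nsform_rank rank_radical_compl.
apply/eqP; rewrite -addr_eq0 addrC -witt_of_nsform -witt_of_sum ?nsform_sym //.
by rewrite witt_of_opp_nondeg ?nsform_sym ?nsform_unit.
Qed.
End WittClass.

(** * Common opposites of finitely many Lagrangians *)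

Section Avoidance.
Variable D : fieldType.
Hypothesis D_infinite : infinite_set [set: D]%classic.

Lemma exists_notin (s : seq D) : exists t, t \notin s.
Proof.
apply: contrapT => /forallNP all_s; apply: D_infinite.
apply: (sub_finite_set _ (finite_seq s)) => t _ /=.
by apply/negPn/negP => /all_s.
Qed.

(** A vector space over an infinite field is not covered by finitely many proper
    subspaces. If [v] avoids all but [U0], and [u] avoids [U0], then the line
    [u + t v] avoids [U0] and meets each other subspace at most once. *)
Lemma avoid_subspaces p m (V : 'M[D]_(p, m)) (Us : seq 'M[D]_m) :
  (forall U, U \in Us -> ~~ (V <= U)%MS) ->
  exists2 v : 'rV_m, (v <= V)%MS & forall U, U \in Us -> ~~ (v <= U)%MS.
Proof.
elim: Us => [|U0 Us IH] VUs; first by exists 0; rewrite ?sub0mx.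
have [|v vV vUs] := IH; first by move=> U UUs; rewrite VUs // inE UUs orbT.
have [vU0|vU0] := boolP (v <= U0)%MS; last first.
  by exists v => // U; rewrite inE => /orP[/eqP->|/vUs].
have /row_subPn[i] := VUs U0 (mem_head _ _); set u := row i V => uU0.
(* The parameter at which the line meets [U], if there is one. *)
pose bad (U : 'M[D]_m) : D := xget 0 [set t | ((u + t *: v)%R <= U)%MS]%classic.
have [t tbad] := exists_notin [seq bad U | U <- Us].
exists (u + t *: v); first by rewrite addmx_sub ?row_sub ?scalemx_sub.
move=> U; rewrite inE => /orP[/eqP->|UUs].
  apply: contra uU0 => utv; rewrite -[u](addrK (t *: v)) addmx_sub //.
  by rewrite eqmx_opp scalemx_sub.
apply/negP => utU.
have ubU : ((u + bad U *: v)%R <= U)%MS.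
  by apply: (@xgetI D 0 [set t | ((u + t *: v)%R <= U)%MS]%classic t).
have tb : t - bad U != 0.
  by rewrite subr_eq0; apply: contraNneq tbad => ->; apply: map_f.
have : ((t - bad U) *: v <= U)%MS.
  have -> : (t - bad U) *: v = (u + t *: v) - (u + bad U *: v).
    by rewrite opprD addrACA subrr add0r scalerBl.
  by rewrite addmx_sub ?eqmx_opp.
by rewrite eqmx_scale // (negbTE (vUs U UUs)).
Qed.

End Avoidance.

Section Perp.
Variables (D : fieldType) (n : nat).
Local Notation J := (symp_mx D n).
Local Notation lag := (lagrangian D n).

Lemma symp_mx_tr : J^T = - J.
Proof. by rewrite /symp_mx tr_block_mx !trmx0 linearN /= !trmx1 opp_block_mx !oppr0 opprK. Qed.

Lemma symp_mx_unit : J \in unitmx.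
Proof.
have /mulmx1_unit[] // : J *m (- J) = 1%:M.
rewrite mulmxN /symp_mx mulmx_block !mul0mx !mulmx0 !addr0 !add0r mulNmx.
by rewrite !(mul1mx, mulmx1) opp_block_mx !oppr0 !opprK -scalar_mx_block.
Qed.

Definition perp k (A : 'M[D]_(k, n + n)) := kermx (J *m A^T).

Lemma sub_perp k l (A : 'M_(k, n + n)) (B : 'M_(l, n + n)) :
  (A <= perp B)%MS = (A *m J *m B^T == 0).
Proof. by rewrite sub_kermx mulmxA. Qed.

Lemma sub_perpC k l (A : 'M_(k, n + n)) (B : 'M_(l, n + n)) :
  (A <= perp B)%MS = (B <= perp A)%MS.
Proof.
rewrite !sub_perp -(inj_eq trmx_inj) trmx0 !trmx_mul trmxK symp_mx_tr.
by rewrite mulNmx mulmxN oppr_eq0 mulmxA.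
Qed.

Lemma rank_perp k (A : 'M_(k, n + n)) : \rank (perp A) = (n + n - \rank A)%N.
Proof.
rewrite mxrank_ker -mxrank_tr trmx_mul trmxK.
by rewrite mxrankMfree // row_free_unit unitmx_tr symp_mx_unit.
Qed.

Lemma sub_perp_perp k (A : 'M_(k, n + n)) : (A <= perp (perp A))%MS.
Proof. by rewrite sub_perpC. Qed.

Lemma perpK k (A : 'M_(k, n + n)) : (perp (perp A) :=: A)%MS.
Proof.
apply: eqmx_sym; apply/eqmxP.
have := mxrank_leqif_eq (sub_perp_perp A); rewrite !rank_perp subKn ?rank_leq_col //.
by move=> [_ <-].
Qed.

Lemma symp_alternating (v : 'rV[D]_(n + n)) : (v <= perp v)%MS.
Proof.
rewrite sub_perp -[v]hsubmxK; move: (lsubmx v) (rsubmx v) => a b.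
rewrite /symp_mx mul_row_block !mulmx0 !mulmxN !mulmx1 add0r addr0 tr_row_mx mul_row_col.
rewrite mulNmx; have -> : b *m a^T = a *m b^T.
  apply/matrixP => i j; rewrite !ord1 !mxE; apply: eq_bigr => c _.
  by rewrite !mxE mulrC.
by rewrite subrr.
Qed.

Definition lag_mx (X : lag) : 'M[D]_(\dim X, n + n) := \matrix_i (tnth (vbasis X) i)^T.

Lemma mem_lag_mx (X : lag) v : (v \in X) = (v^T <= lag_mx X)%MS.
Proof.
apply/idP/submxP => [vX|[a vE]].
  exists (\row_i coord (vbasis X) i v); apply: trmx_inj; rewrite trmxK.
  rewrite {1}(coord_vbasis vX) mulmx_sum_row linear_sum.
  apply: eq_bigr => i _.
  by rewrite mxE linearZ /= rowK trmxK (tnth_nth 0).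
rewrite -[v]trmxK vE mulmx_sum_row linear_sum memv_suml // => i _.
by rewrite linearZ /= rowK trmxK memvZ // vbasis_mem ?mem_tnth.
Qed.

Lemma symp_form_eq0 (u v : 'cV[D]_(n + n)) :
  (symp_form u v == 0) = (u^T <= perp v^T)%MS.
Proof.
rewrite sub_perp trmxK /symp_form; apply/eqP/eqP => [uv|->]; last by rewrite mxE.
by apply/matrixP => i j; rewrite !ord1 uv mxE.
Qed.

Lemma eqmx_rV k l (A : 'M[D]_(k, n + n)) (B : 'M_(l, n + n)) :
  (forall v : 'rV_(n + n), (v <= A)%MS = (v <= B)%MS) -> (A :=: B)%MS.
Proof. by move=> AB; apply/eqmxP/andP; split; apply/rV_subP => v; rewrite AB. Qed.

Lemma lag_mx_perp (X : lag) : (lag_mx X :=: perp (lag_mx X))%MS.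
Proof.
apply: eqmx_rV => v; have := mem_lag_mx X v^T; rewrite trmxK => <-.
have /asboolP vX := valP X; apply/idP/idP => [/vX vP|vP].
  rewrite sub_perpC; apply/row_subP => i; rewrite rowK.
  by rewrite -[v]trmxK -symp_form_eq0 vP // vbasis_mem ?mem_tnth.
apply/vX => u; rewrite mem_lag_mx => uX; apply/eqP.
by rewrite symp_form_eq0 trmxK (submx_trans uX) // sub_perpC.
Qed.

Lemma lag_mx_rank (X : lag) : \rank (lag_mx X) = n.
Proof.
have := rank_perp (lag_mx X); rewrite -lag_mx_perp => r.
have := rank_leq_col (lag_mx X); move: (\rank _) r => m mE mle.
have : (m + m = n + n)%N by rewrite {1}mE subnK.
by rewrite !addnn => /double_inj.
Qed.

Lemma oppositeE (X Y : lag) : opposite X Y = ((lag_mx X :&: lag_mx Y)%MS == 0).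
Proof.
apply/eqP/eqP => [XY|XY].
  apply/eqP; rewrite -submx0; apply/rV_subP => v; rewrite sub_capmx => /andP[vX vY].
  have : v^T \in (X :&: Y)%VS by rewrite memv_cap !mem_lag_mx trmxK vX.
  by rewrite XY memv0 => /eqP/(congr1 trmx); rewrite trmxK trmx0 => ->; rewrite sub0mx.
apply/eqP; rewrite -subv0; apply/subvP => v; rewrite memv_cap !mem_lag_mx -sub_capmx XY.
by rewrite submx0 memv0 => /eqP/(congr1 trmx); rewrite trmxK trmx0 => ->.
Qed.

Lemma lagrangian_of_mx k (W : 'M_(k, n + n)) : (W :=: perp W)%MS ->
  exists X : lag, (lag_mx X :=: W)%MS.
Proof.
move=> W_perp; pose L : {vspace 'cV[D]_(n + n)} := lker (linfun (mulmx (W *m J))).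
have memL v : (v \in L) = (v^T <= W)%MS.
  by rewrite memv_ker lfunE /= -[v in LHS]trmxK -sub_perp sub_perpC -W_perp.
have L_lag : is_lagrangian L.
  apply/asboolP => v; rewrite memL W_perp sub_perpC; split=> [Wv u|vP].
    by rewrite memL => uW; apply/eqP; rewrite symp_form_eq0 (submx_trans uW).
  apply/row_subP => i; rewrite -[row i W]trmxK -symp_form_eq0 vP // memL trmxK.
  exact: row_sub.
exists (Lagrangian L_lag); apply: eqmx_rV => v.
by have := mem_lag_mx (Lagrangian L_lag) v^T; rewrite trmxK => <-; rewrite memL trmxK.
Qed.

Hypothesis D_infinite : infinite_set [set: D]%classic.

(** A new vector [v] orthogonal to [W] must avoid [W] and every [W + X]. If
    [perp W] were contained in [W + X], then [perp W] and [X] would intersect in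
    vectors orthogonal to [perp W], that is in vectors of [W], hence trivially;
    but their dimensions add up to more than [2n]. *)
Lemma isotropic_extension (Xs : seq lag) (W : 'M_(n + n)) :
  (W <= perp W)%MS -> (\rank W < n)%N ->
  (forall X, X \in Xs -> (W :&: lag_mx X)%MS == 0) ->
  exists W' : 'M_(n + n), [/\ (W' <= perp W')%MS, (\rank W < \rank W')%N &
     forall X, X \in Xs -> (W' :&: lag_mx X)%MS == 0].
Proof.
move=> W_iso W_small W_Xs.
have [|v vW vXs] := @avoid_subspaces _ D_infinite _ _ (perp W)
    (W :: [seq (W + lag_mx X)%MS | X <- Xs]).
  move=> U; rewrite inE => /orP[/eqP->|/mapP[X XXs ->]]; apply/negP => WX.
    have := mxrankS WX; rewrite rank_perp leqNgt => /negP[].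
    by rewrite ltn_subRL; move: (\rank W) W_small => r rn; rewrite !addnn ltn_double.
  have : (perp W :&: lag_mx X <= W :&: lag_mx X)%MS.
    rewrite sub_capmx capmxSr andbT -(perpK W) sub_perpC.
    apply: submx_trans WX _; rewrite addsmx_sub sub_perpC capmxSl /=.
    by rewrite sub_perpC -(lag_mx_perp X) capmxSr.
  rewrite (eqP (W_Xs X XXs)) submx0 -mxrank_eq0 => /eqP r0.
  have := mxrank_sum_cap (perp W) (lag_mx X); rewrite r0 addn0 rank_perp lag_mx_rank => rE.
  have := rank_leq_col (perp W + lag_mx X)%MS; rewrite rE.
  move: (\rank W) W_small => r rn.
  by rewrite addnC leq_add2l leq_subLR leq_add2r leqNgt rn.
have v_new X : X \in Xs -> ~~ (v <= W + lag_mx X)%MS.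
  by move=> XXs; apply: vXs; rewrite inE map_f ?orbT.
exists (W + v)%MS; split.
- rewrite addsmx_sub (sub_perpC W) (sub_perpC v) !addsmx_sub W_iso vW symp_alternating.
  by rewrite sub_perpC vW.
- have v_W : ~~ (v <= W)%MS by apply: vXs; rewrite inE eqxx.
  apply: rank_ltmx; rewrite /ltmx addsmxSl addsmx_sub submx_refl /=.
  exact: v_W.
- move=> X XXs; rewrite -submx0; apply/rV_subP => u.
  rewrite sub_capmx => /andP[/sub_addsmxP[[a b] /= uE] uX].
  have [b0|b0] := eqVneq (b 0 0) 0.
    rewrite -(eqP (W_Xs X XXs)) sub_capmx uX andbT uE [b]mx11_scalar b0.
    by rewrite mul_scalar_mx scale0r addr0 submxMl.
  case/negP: (v_new X XXs); rewrite -(eqmx_scale v b0) -mul_scalar_mx -mx11_scalar.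
  have -> : b *m v = u - a *m W by rewrite uE addrC addKr.
  by rewrite addrC addmx_sub_adds ?eqmx_opp ?submxMl.
Qed.

Theorem common_opposite (Xs : seq lag) : exists W : lag, all (opposite W) Xs.
Proof.
have [W [W_iso W_rank W_Xs]] : exists W : 'M[D]_(n + n),
    [/\ (W <= perp W)%MS, (n <= \rank W)%N & forall X, X \in Xs -> (W :&: lag_mx X)%MS == 0].
  suff grow k : (k <= n)%N -> exists W : 'M[D]_(n + n),
    [/\ (W <= perp W)%MS, (k <= \rank W)%N &
      forall X, X \in Xs -> (W :&: lag_mx X)%MS == 0] by exact: grow.
  elim: k => [_|k IH kn]; first by exists 0; split=> [||X _]; rewrite ?sub0mx // cap0mx.
  have [W [W_iso W_rank W_Xs]] := IH (ltnW kn).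
  have [Wn|Wn] := leqP n (\rank W); first by exists W; split=> //; apply: leq_trans Wn.
  have [W' [W'_iso W'_rank W'_Xs]] := isotropic_extension W_iso Wn W_Xs.
  by exists W'; split=> //; apply: leq_ltn_trans W'_rank.
have /lagrangian_of_mx[L LE] : (W :=: perp W)%MS.
  apply/eqmxP; have [_ <-] := mxrank_leqif_eq W_iso.
  rewrite eqn_leq mxrankS // rank_perp leq_subLR.
  by rewrite leq_add.
exists L; apply/allP => X XXs.
by rewrite oppositeE -submx0 (cap_eqmx LE (eqmx_refl _)) submx0 W_Xs.
Qed.

End Perp.

(** * Kashiwara's form in coordinates *)

Section Gram.
Variable D : fieldType.
Hypothesis D_char : 2%N \notin [pchar D].

Lemma rank_congr k m (S : 'M[D]_k) (S' : 'M_m) (g : 'M_(k, m)) :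
  S = g *m S' *m g^T -> (\rank S <= \rank S')%N.
Proof.
by move=> ->; rewrite (leq_trans (mxrankM_maxl _ _)) // mxrankM_maxr.
Qed.

Lemma mulmx_form_entry p r k (g : 'M[D]_(p, k)) (S : 'M_k) (h : 'M_(r, k)) i j :
  (g *m S *m h^T) i j = (row i g *m S *m (row j h)^T) 0 0.
Proof. by rewrite -row_mul tr_row !mxE; apply: eq_bigr => l _; rewrite !mxE. Qed.

Lemma polar_param (V : vectType D) (q : V -> D) k (S : 'M[D]_k)
    (f : {linear 'rV[D]_k -> V}) :
  S^T = S -> (forall a, q (f a) = (a *m S *m a^T) 0 0) ->
  forall a b, polar q (f a) (f b) = (a *m S *m b^T) 0 0.
Proof.
move=> S_sym qf a b; rewrite /polar -raddfD !qf raddfD /= !mulmxDl !mulmxDr.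
have -> : b *m S *m a^T = a *m S *m b^T.
  apply/matrixP => i j; rewrite !ord1 -[b *m S *m _]trmxK mxE.
  by rewrite !trmx_mul S_sym trmxK mulmxA.
move: (a *m S *m a^T) (a *m S *m b^T) (b *m S *m b^T) => A B C.
rewrite !mxE; move: (A 0 0) (B 0 0) (C 0 0) => u w v.
have -> : u + w + (w + v) - u - v = w * 2%:R.
  by ring.
by rewrite mulfK ?(two_neq0 D_char).
Qed.

(** The nondegenerate part can be read off from any linear parametrisation of
    the space, even a redundant one. *)
Lemma nondeg_class_param (V : vectType D) (q : V -> D) k (S : 'M[D]_k)
    (f : {linear 'rV[D]_k -> V}) :
  S^T = S -> (forall v, exists a, f a = v) ->
  (forall a, q (f a) = (a *m S *m a^T) 0 0) -> nondeg_class q = witt_of S.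
Proof.
move=> S_sym f_surj qf; have polar_f := polar_param S_sym qf.
have /choice[sec secK] := f_surj.
pose e i := (vbasis {:V})`_i.
pose g := \matrix_(i < \dim {:V}) sec (e i).
have gramE : gram q = g *m S *m g^T.
  apply/matrixP => i j; rewrite mulmx_form_entry mxE -/(e i) -/(e j).
  by rewrite -{1}(secK (e i)) -{1}(secK (e j)) polar_f !rowK.
pose c := \matrix_(i < k, l < \dim {:V}) coord (vbasis {:V}) l (f (delta_mx 0 i)).
have SE : S = c *m gram q *m c^T.
  have cg i : f (delta_mx 0 i) = f (row i c *m g).
    rewrite mulmx_sum_row linear_sum {1}(coord_vbasis (memvf (f (delta_mx 0 i)))).
    by apply: eq_bigr => l _; rewrite linearZZ /= !mxE rowK secK.
  apply/matrixP => i j; rewrite gramE.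
  have -> : c *m (g *m S *m g^T) *m c^T = (c *m g) *m S *m (c *m g)^T.
    by rewrite trmx_mul !mulmxA.
  rewrite mulmx_form_entry !row_mul -polar_f -!cg polar_f.
  by rewrite -rowE trmx_delta -colE !mxE.
rewrite /nondeg_class -witt_ofE.
apply: (witt_of_congr (gram_sym q) S_sym gramE).
by apply/eqP; rewrite eqn_leq (rank_congr gramE) (rank_congr SE).
Qed.

End Gram.

Section Kashiwara.
Variables (D : fieldType) (n : nat).
Hypothesis D_char : 2%N \notin [pchar D].
Local Notation J := (symp_mx D n).
Local Notation lag := (lagrangian D n).
Local Notation frame := 'M[D]_(n, n + n).

Definition pairing (A B : frame) : 'M_n := A *m J *m B^T.

Lemma pairing_tr A B : (pairing A B)^T = - pairing B A.
Proof. by rewrite /pairing !trmx_mul trmxK symp_mx_tr mulNmx mulmxN mulmxA. Qed.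

Lemma pairingB A A' B B' : pairing (A - A') (B - B') =
  pairing A B - pairing A B' - (pairing A' B - pairing A' B').
Proof. by rewrite /pairing [(B - B')^T]raddfB /= mulmxBr !mulmxBl !opprD addrACA. Qed.

Lemma symp_form_pairing (a b : 'rV[D]_n) A B :
  symp_form (a *m A)^T (b *m B)^T = (a *m pairing A B *m b^T) 0 0.
Proof. by rewrite /symp_form trmxK trmx_mul /pairing !mulmxA. Qed.

Definition kashiwara_index (X Y Z : lag) : witt D := nondeg_class (@kashiwara_form _ _ X Y Z).

(** [L], [M] and [N] extract from a parameter vector the coordinates of the three
    components; the freedom in choosing them replaces a congruence of block
    matrices. *)
Lemma kashiwara_index_param (X Y Z : lag) (A B C : frame) k (L M N : 'M_(k, n)) (S : 'M_k) :
  (A :=: lag_mx X)%MS -> (B :=: lag_mx Y)%MS -> (C :=: lag_mx Z)%MS ->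
  S^T = S ->
  (forall a b c, exists v : 'rV_k, [/\ v *m L = a, v *m M = b & v *m N = c]) ->
  (forall v : 'rV_k, v *m S *m v^T = v *m L *m pairing A B *m (v *m M)^T +
     v *m M *m pairing B C *m (v *m N)^T + v *m N *m pairing C A *m (v *m L)^T) ->
  kashiwara_index X Y Z = witt_of S.
Proof.
move=> AX BY CZ S_sym LMN_surj SE.
pose f (v : 'rV_k) : subvs_of X * subvs_of Y * subvs_of Z :=
  (vsproj X (v *m L *m A)^T, vsproj Y (v *m M *m B)^T, vsproj Z (v *m N *m C)^T).
have f_lin : linear f.
  move=> a u v; rewrite /f !mulmxDl -!scalemxAl !linearP.
  by congr (_, _, _).
pose f_linear : {linear 'rV[D]_k -> (subvs_of X * subvs_of Y * subvs_of Z)%type} :=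
  HB.pack f (GRing.isLinear.Build _ _ _ _ f f_lin).
have projK (U : lag) (E : frame) (a : 'rV_n) : (E :=: lag_mx U)%MS ->
    vsval (vsproj U (a *m E)^T) = (a *m E)^T.
  by move=> EU; rewrite vsprojK // mem_lag_mx trmxK -EU submxMl.
have coords (U : lag) (E : frame) (u : subvs_of U) : (E :=: lag_mx U)%MS ->
    exists a, u = vsproj U (a *m E)^T.
  move=> EU; have := subvsP u; rewrite mem_lag_mx -EU => /submxP[a uE].
  by exists a; apply: val_inj; rewrite /= projK // -uE trmxK.
apply: (nondeg_class_param D_char (f := f_linear) S_sym) => [[[x y] z]|v].
  have [a ->] := coords _ _ x AX; have [b ->] := coords _ _ y BY.
  have [c ->] := coords _ _ z CZ; have [v [va vb vc]] := LMN_surj a b c.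
  by exists v; rewrite /= /f va vb vc.
rewrite /= /kashiwara_form /= !projK // !symp_form_pairing SE.
have mxD (E F : 'M[D]_1) : (E + F) 0 0 = E 0 0 + F 0 0 by rewrite mxE.
by rewrite !mxD.
Qed.

Section DualFrames.
Variables (W : lag) (B : frame).
Hypothesis BW : (B :=: lag_mx W)%MS.

Definition dual_frame (A : frame) := pairing A B = 1%:M.

(** The difference is orthogonal to [W], and [W] is its own orthogonal. *)
Lemma dual_frame_sub A A' : dual_frame A -> dual_frame A' -> (A - A' <= lag_mx W)%MS.
Proof.
move=> AB A'B; rewrite lag_mx_perp sub_perpC -BW sub_perpC sub_perp !mulmxBl.
by rewrite -/(pairing A B) -/(pairing A' B) AB A'B subrr.
Qed.

Lemma pairing_lag (X : lag) A A' :
  (A <= lag_mx X)%MS -> (A' <= lag_mx X)%MS -> pairing A A' = 0.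
Proof.
move=> AX A'X; apply/eqP; rewrite -[_ == 0]sub_perp (submx_trans AX) //.
by rewrite sub_perpC (submx_trans A'X) // lag_mx_perp.
Qed.

(** Both this and the next lemma expand the pairing of two differences of dual
    frames, which is zero because these differences lie in [W]. *)
Lemma pairing_dual_sym (X Y : lag) A A' :
  (A :=: lag_mx X)%MS -> (A' :=: lag_mx Y)%MS -> dual_frame A -> dual_frame A' ->
  (pairing A A')^T = pairing A A'.
Proof.
move=> AX A'Y AB A'B; rewrite pairing_tr; apply/eqP; rewrite eq_sym -subr_eq0 opprK.
have := pairing_lag (dual_frame_sub AB A'B) (dual_frame_sub AB A'B).
rewrite pairingB (@pairing_lag X A A) ?AX // (@pairing_lag Y A' A') ?A'Y //.
by rewrite sub0r subr0 -opprD => /eqP; rewrite oppr_eq0.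
Qed.

Lemma pairing_dual_cocycle (X Y Z : lag) A A' A'' :
  (A :=: lag_mx X)%MS -> (A' :=: lag_mx Y)%MS -> (A'' :=: lag_mx Z)%MS ->
  dual_frame A -> dual_frame A' -> dual_frame A'' ->
  pairing A A' + pairing A' A'' + pairing A'' A = 0.
Proof.
move=> AX A'Y A''Z AB A'B A''B.
have := pairing_lag (dual_frame_sub AB A''B) (dual_frame_sub A'B A''B).
rewrite pairingB (@pairing_lag Z A'' A'') ?A''Z // subr0.
rewrite -(pairing_dual_sym AX A''Z) // pairing_tr opprK.
rewrite -(pairing_dual_sym A''Z A'Y) // pairing_tr opprK.
by rewrite addrAC.
Qed.

(** In dual frames Kashiwara's form is [x P y^T + y R z^T + z Q x^T], where
    [P + R + Q = 0]. Substituting [x = b + c], [y = a + c], [z = a + b], which is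
    invertible as 2 is, all mixed terms cancel and
    [a R a^T + b Q b^T + c P c^T] remains. *)
Lemma kashiwara_index_dual (X Y Z : lag) A A' A'' :
  (A :=: lag_mx X)%MS -> (A' :=: lag_mx Y)%MS -> (A'' :=: lag_mx Z)%MS ->
  dual_frame A -> dual_frame A' -> dual_frame A'' ->
  kashiwara_index X Y Z =
    witt_of (pairing A A') + witt_of (pairing A' A'') + witt_of (pairing A'' A).
Proof.
move=> AX A'Y A''Z AB A'B A''B.
set P := pairing A A'; set R := pairing A' A''; set Q := pairing A'' A.
have P_sym : P^T = P by apply: pairing_dual_sym AX A'Y _ _.
have R_sym : R^T = R by apply: pairing_dual_sym A'Y A''Z _ _.
have Q_sym : Q^T = Q by apply: pairing_dual_sym A''Z AX _ _.
have PRQ : P + R + Q = 0 by apply: pairing_dual_cocycle AX A'Y A''Z _ _ _.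
have QE : Q = - (P + R) by apply/eqP; rewrite -addr_eq0 addrC PRQ.
pose i1 : 'M[D]_(n + (n + n), n) := col_mx 1%:M 0.
pose i2 : 'M[D]_(n + (n + n), n) := col_mx 0 (col_mx 1%:M 0).
pose i3 : 'M[D]_(n + (n + n), n) := col_mx 0 (col_mx 0 1%:M).
rewrite (@kashiwara_index_param X Y Z A A' A'' _ (i2 + i3) (i1 + i3) (i1 + i2)
   (block_mx R 0 0 (block_mx Q 0 0 P))) //.
- rewrite !witt_of_sum ?tr_block_mx ?P_sym ?R_sym ?Q_sym ?trmx0 //.
  by rewrite addrC [witt_of Q + _]addrC addrAC.
- by rewrite !tr_block_mx !trmx0 P_sym R_sym Q_sym.
- move=> a b c; pose h : D := 2%:R^-1.
  have hh : h + h = 1 by rewrite -mulr2n -(mulr_natr h) mulVf ?(two_neq0 D_char).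
  (* The inverse of the substitution x = b + c, y = a + c, z = a + b. *)
  exists (row_mx (h *: (b + c - a)) (row_mx (h *: (a + c - b)) (h *: (a + b - c)))).
  rewrite !mulmxDr !mul_row_col !mulmx0 !mulmx1 !addr0 !add0r.
  by split; apply/rowP => j; rewrite !mxE -[RHS]mul1r -hh; ring.
move=> v; rewrite -[v]hsubmxK -[rsubmx v]hsubmxK.
move: (lsubmx v) (lsubmx (rsubmx v)) (rsubmx (rsubmx v)) => a b c.
rewrite !mul_row_block !mulmx0 !addr0 !add0r !tr_row_mx.
rewrite !mulmxDr !mul_row_col !mulmx0 !mulmx1 !addr0 !add0r.
rewrite -/P -/R -/Q; apply/matrixP => i j; rewrite !ord1.
have mxD (E F : 'M[D]_1) : (E + F) 0 0 = E 0 0 + F 0 0 by rewrite mxE.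
have swap (S : 'M[D]_n) (u w : 'rV[D]_n) :
    S^T = S -> (u *m S *m w^T) 0 0 = (w *m S *m u^T) 0 0.
  move=> S_sym; have -> : u *m S *m w^T = (w *m S *m u^T)^T.
    by rewrite !trmx_mul trmxK S_sym mulmxA.
  by rewrite mxE.
have crossQ (u w : 'rV[D]_n) :
    (u *m Q *m w^T) 0 0 = - (u *m P *m w^T) 0 0 - (u *m R *m w^T) 0 0.
  by rewrite QE mulmxN mulNmx mulmxDr mulmxDl [LHS]mxE mxD opprD.
rewrite !raddfD /= !(mulmxDl, mulmxDr) !mxD.
rewrite (swap P b a) // (swap R c b) // (swap P c a) // (swap R c a) //.
rewrite (crossQ a b) (crossQ a c) (crossQ b c).
by ring.
Qed.
End DualFrames.

End Kashiwara.

(** * Cocycle property and comparison with [kappa] *)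

Section MaslovIndex.
Variables (D : fieldType) (n : nat).
Hypothesis D_char : 2%N \notin [pchar D].
Local Notation J := (symp_mx D n).
Local Notation lag := (lagrangian D n).
Local Notation frame := 'M[D]_(n, n + n).

Lemma exists_frame (X : lag) : exists A : frame, (A :=: lag_mx X)%MS.
Proof.
have := eq_row_base (lag_mx X); move: (row_base _); rewrite lag_mx_rank => A AX.
by exists A.
Qed.

Lemma frame_free (X : lag) (A : frame) : (A :=: lag_mx X)%MS -> row_free A.
Proof. by move=> AX; rewrite /row_free AX lag_mx_rank. Qed.

(** Opposition says exactly that the pairing between [X] and [W] is perfect. *)
Lemma exists_dual_frame (W X : lag) (B : frame) :
  (B :=: lag_mx W)%MS -> opposite W X ->
  exists2 A, (A :=: lag_mx X)%MS & dual_frame B A.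
Proof.
move=> BW WX; have [A AX] := exists_frame X.
have pU : pairing A B \in unitmx.
  rewrite -row_free_unit -kermx_eq0 -submx0; apply/rV_subP => a /sub_kermxP aAB.
  have : (a *m A <= lag_mx W :&: lag_mx X)%MS.
    rewrite sub_capmx -AX submxMl andbT lag_mx_perp sub_perpC -BW sub_perpC sub_perp.
    by rewrite -mulmxA -mulmxA (mulmxA A) -/(pairing A B) aAB.
  rewrite oppositeE in WX; rewrite (eqP WX) submx0 mulmx_free_eq0 ?(frame_free AX) //.
  by rewrite submx0.
exists (invmx (pairing A B) *m A).
  apply: eqmx_trans AX; apply: eqmxMfull.
  by rewrite row_full_unit unitmx_inv.
by rewrite /dual_frame -[RHS](mulVmx pU) /pairing !mulmxA.
Qed.

Lemma lag_mx_act g (X : lag) : (lag_mx (lag_act g X) :=: lag_mx X *m g^T)%MS.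
Proof.
apply: eqmx_rV => v.
have := mem_lag_mx (lag_act g X) v^T; rewrite trmxK => <-.
rewrite mem_sp_lfun mem_lag_mx lfunE /= trmx_mul trmxK.
have gU : row_free g^T by rewrite row_free_unit unitmx_tr sp_unitmx.
rewrite -(submxMfree _ _ gU) -mulmxA -trmx_mul.
by rewrite mulmxV ?sp_unitmx // trmx1 mulmx1.
Qed.

Lemma pairing_act (g : Sp D n) (A B : frame) : pairing (A *m g^T) (B *m g^T) = pairing A B.
Proof.
by rewrite /pairing trmx_mul trmxK !mulmxA -!(mulmxA A) sp_mxP.
Qed.

Lemma witt_pairing_sym W B X Y (A A' : frame) :
  (B :=: lag_mx W)%MS -> (A :=: lag_mx X)%MS -> (A' :=: lag_mx Y)%MS ->
  dual_frame B A -> dual_frame B A' ->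
  witt_of (pairing A' A) = - witt_of (pairing A A').
Proof.
move=> BW AX A'Y AB A'B; have PS := pairing_dual_sym BW AX A'Y AB A'B.
by rewrite -witt_ofN // -pairing_tr pairing_tr -PS pairing_tr opprK.
Qed.

Hypothesis D_infinite : infinite_set [set: D]%classic.

(** With dual frames relative to a common opposite, the index is a sum of three
    edge terms, and the edge terms cancel in pairs. *)
Lemma kashiwara_index_cocycle (X Y Z T : lag) :
  kashiwara_index Y Z T - kashiwara_index X Z T +
  kashiwara_index X Y T - kashiwara_index X Y Z = 0.
Proof.
have [W /and5P[WX WY WZ WT _]] := common_opposite D_infinite [:: X; Y; Z; T].
have [B BW] := exists_frame W.
have [A1 A1X A1B] := exists_dual_frame BW WX.
have [A2 A2Y A2B] := exists_dual_frame BW WY.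
have [A3 A3Z A3B] := exists_dual_frame BW WZ.
have [A4 A4T A4B] := exists_dual_frame BW WT.
rewrite (kashiwara_index_dual D_char BW A2Y A3Z A4T) //.
rewrite (kashiwara_index_dual D_char BW A1X A3Z A4T) //.
rewrite (kashiwara_index_dual D_char BW A1X A2Y A4T) //.
rewrite (kashiwara_index_dual D_char BW A1X A2Y A3Z) //.
rewrite (witt_pairing_sym BW A1X A3Z) // (witt_pairing_sym BW A2Y A4T) //.
move: (witt_of (pairing A1 A2)) (witt_of (pairing A2 A3)) (witt_of (pairing A3 A4))
  (witt_of (pairing A2 A4)) (witt_of (pairing A1 A3)) (witt_of (pairing A4 A1)).
move=> w12 w23 w34 w24 w13 w41.
rewrite (addrAC w23) (addrC w13) -(addrA w34) addrKA [X in X - _]addrC (addrACA (w12 + w24)).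
have -> : w41 - (w13 + w41) = - w13 by rewrite opprD addrCA subrr addr0.
by rewrite (addrACA w12) subrr addr0 subrr.
Qed.

Lemma kashiwara_index_inv g (X Y Z : lag) :
  kashiwara_index (lag_act g X) (lag_act g Y) (lag_act g Z) =
  kashiwara_index X Y Z.
Proof.
have [W /and4P[WX WY WZ _]] := common_opposite D_infinite [:: X; Y; Z].
have [B BW] := exists_frame W.
have [A1 A1X A1B] := exists_dual_frame BW WX.
have [A2 A2Y A2B] := exists_dual_frame BW WY.
have [A3 A3Z A3B] := exists_dual_frame BW WZ.
have act U (A : frame) : (A :=: lag_mx U)%MS -> (A *m g^T :=: lag_mx (lag_act g U))%MS.
  by move=> AU; apply: eqmx_trans (eqmxMr _ AU) (eqmx_sym (lag_mx_act g U)).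
rewrite (kashiwara_index_dual D_char (act _ _ BW) (act _ _ A1X) (act _ _ A2Y) (act _ _ A3Z));
  rewrite /dual_frame ?pairing_act //.
by rewrite (kashiwara_index_dual D_char BW A1X A2Y A3Z).
Qed.

Lemma kashiwara_index_degenerate (X Y : lag) :
  [/\ kashiwara_index X X Y = 0, kashiwara_index X Y X = 0
    & kashiwara_index Y X X = 0].
Proof.
have [W /and3P[WX WY _]] := common_opposite D_infinite [:: X; Y].
have [B BW] := exists_frame W.
have [A AX AB] := exists_dual_frame BW WX.
have [A' A'Y A'B] := exists_dual_frame BW WY.
rewrite (kashiwara_index_dual D_char BW AX AX A'Y) //.
rewrite (kashiwara_index_dual D_char BW AX A'Y AX) //.
rewrite (kashiwara_index_dual D_char BW A'Y AX AX) // (@pairing_lag _ _ X A A) ?AX // witt_of0.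
by rewrite (witt_pairing_sym BW AX A'Y) // !(add0r, addr0) subrr addNr.
Qed.

(** Here the form is [- x y^T + y t z^T + z x^T]. With [y = b], [z = b + d] and
    [x = e - b t] it becomes [b t b^T + e d^T], the sum of [t] and a hyperbolic
    form. *)
Lemma kashiwara_index_kappa (X Y Z : lag) (B A : frame) (t : 'M[D]_n) :
  (B :=: lag_mx X)%MS -> (A :=: lag_mx Y)%MS -> ((A + t *m B)%R :=: lag_mx Z)%MS ->
  dual_frame B A -> t^T = t -> kashiwara_index X Y Z = witt_of t.
Proof.
move=> BX AY CZ AB t_sym; set C := A + t *m B in CZ.
have BA : pairing B A = - 1%:M by rewrite -[LHS]opprK -pairing_tr AB trmx1.
have BB : pairing B B = 0 by apply: (@pairing_lag _ _ X); rewrite BX.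
have AA : pairing A A = 0 by apply: (@pairing_lag _ _ Y); rewrite AY.
have AC : pairing A C = t.
  by rewrite /pairing linearD /= mulmxDr trmx_mul mulmxA -!/(pairing A _) AA AB add0r mul1mx.
have CB : pairing C B = 1%:M.
  rewrite /pairing !mulmxDl -!mulmxA (mulmxA A) (mulmxA B).
  by rewrite -!/(pairing _ B) AB BB mulmx0 addr0.
pose h : D := 2%:R^-1.
have hh : h + h = 1 by rewrite -mulr2n -(mulr_natr h) mulVf ?(two_neq0 D_char).
have h0 : h != 0 by rewrite invr_eq0 (two_neq0 D_char).
pose L : 'M[D]_(n + (n + n), n) := col_mx (- t) (col_mx 1%:M 0).
pose M : 'M[D]_(n + (n + n), n) := col_mx 1%:M (col_mx 0 0).
pose N : 'M[D]_(n + (n + n), n) := col_mx 1%:M (col_mx 0 1%:M).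
pose H : 'M[D]_(n + n) := block_mx 0 h%:M h%:M 0.
have H_sym : H^T = H by rewrite tr_block_mx !trmx0 !tr_scalar_mx.
rewrite (@kashiwara_index_param _ _ D_char X Y Z B A C _ L M N (block_mx t 0 0 H)) //.
- rewrite witt_of_sum // witt_of_antidiag ?addr0 //; first exact: tr_scalar_mx.
  by rewrite unitmxE det_scalar unitrX // unitfE.

- by rewrite tr_block_mx !trmx0 t_sym H_sym.
- move=> a b c; exists (row_mx b (row_mx (a + b *m t) (c - b))).
  rewrite !mul_row_col !mulmx0 !mulmx1 !addr0 !add0r mulmxN.
  by split=> //; [rewrite addrC addrK | rewrite addrC subrK].
move=> v; rewrite -[v]hsubmxK -[rsubmx v]hsubmxK.
move: (lsubmx v) (lsubmx (rsubmx v)) (rsubmx (rsubmx v)) => b e d.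
rewrite !mul_row_block !mulmx0 !addr0 !add0r !tr_row_mx.
rewrite !mul_row_col !mulmx0 !mulmx1 !addr0 !add0r BA AC CB.
rewrite !mulmxN !mulmx1 !mul_mx_scalar -!scalemxAl.
rewrite !raddfD /= [(- (b *m t))^T]raddfN /= trmx_mul t_sym.
rewrite !(mulmxDl, mulmxDr) !(mulmxN, mulNmx) !mulmxA.
apply/matrixP => i j; rewrite !ord1.
have mxD (E F : 'M[D]_1) : (E + F) 0 0 = E 0 0 + F 0 0 by rewrite mxE.
have mxN (E : 'M[D]_1) : (- E) 0 0 = - E 0 0 by rewrite mxE.
have mxZ (E : 'M[D]_1) : (h *: E) 0 0 = h * E 0 0 by rewrite mxE.
have mx_tr (E F : 'M[D]_1) : E = F^T -> E 0 0 = F 0 0 by move=> ->; rewrite mxE.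
rewrite !(mxD, mxN, mxZ) (mx_tr (d *m e^T) (e *m d^T)) ?trmx_mul ?trmxK //.
rewrite (mx_tr (d *m t *m b^T) (b *m t *m d^T)) ?trmx_mul ?trmxK ?t_sym ?mulmxA //.
rewrite (mx_tr (b *m e^T) (e *m b^T)) ?trmx_mul ?trmxK //.
have -> : h * (e *m d^T) 0 0 + h * (e *m d^T) 0 0 = (e *m d^T) 0 0.
  by rewrite -mulrDl hh mul1r.
by ring.
Qed.

(** Turns a dimension count into a spanning statement. *)
Lemma frame_of_free (X : lag) (A : frame) :
  (A <= lag_mx X)%MS -> row_free A -> (A :=: lag_mx X)%MS.
Proof.
move=> AX A_free; apply/eqmxP; have [_ <-] := mxrank_leqif_eq AX.
by rewrite lag_mx_rank.
Qed.

Definition cols_of (A : frame) : n.-tuple 'cV[D]_(n + n) := [tuple (row i A)^T | i < n].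

Lemma basis_cols_of (X : lag) (A : frame) :
  (A :=: lag_mx X)%MS -> basis_of X (cols_of A).
Proof.
move=> AX; have dimX : (n <= \dim X)%N.
  by have := rank_leq_row (lag_mx X); rewrite lag_mx_rank.
rewrite basisEdim size_tuple dimX andbT.
apply/subvP => v; rewrite mem_lag_mx -AX => /submxP[a vE].
rewrite -[v]trmxK vE mulmx_sum_row linear_sum memv_suml // => i _.
rewrite linearZ memvZ // memv_span //.
by have := mem_tnth i (cols_of A); rewrite tnth_mktuple.
Qed.

Lemma row_cols_of A i : tnth (cols_of A) i = (row i A)^T.
Proof. by rewrite tnth_mktuple. Qed.

Lemma row_combination (A B : frame) (t : 'M[D]_n) nu : t^T = t ->
  (row nu A)^T + \sum_mu t mu nu *: (row mu B)^T = (row nu (A + t *m B))^T.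
Proof.
move=> t_sym; rewrite raddfD /= raddfD /= row_mul mulmx_sum_row linear_sum.
congr (_ + _); apply: eq_bigr => mu _.
by rewrite linearZ /= -{1}t_sym !mxE.
Qed.

Lemma kashiwara_index_is_kappa (X Y Z : lag) (t : nsform D n) :
  is_kappa X Y Z t -> kashiwara_index X Y Z = witt_class t.
Proof.
move=> [x [y [xX yY xy zZ]]].
pose B : frame := \matrix_i (tnth x i)^T; pose A : frame := \matrix_i (tnth y i)^T.
have AB : pairing A B = 1%:M.
  apply/matrixP => mu nu; rewrite /pairing mulmx_form_entry !rowK trmxK.
  by rewrite -[LHS]/(symp_form _ _) xy mxE.
have rowE nu : tnth y nu + \sum_mu t mu nu *: tnth x mu = (row nu (A + t *m B))^T.
  rewrite -row_combination ?nsform_sym // rowK trmxK; congr (_ + _).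
  by apply: eq_bigr => mu _; rewrite rowK trmxK.
have A_free : row_free A.
  by apply/row_freeP; exists (J *m B^T); rewrite mulmxA.
have B_free : row_free B.
  apply/row_freeP; exists (- J *m A^T).
  by rewrite mulmxA mulmxN mulNmx -/(pairing B A) -pairing_tr AB trmx1.
have BX : (B :=: lag_mx X)%MS.
  apply: frame_of_free => //; apply/row_subP => i; rewrite rowK.
  by rewrite -mem_lag_mx (basis_mem xX) ?mem_tnth.
have AY : (A :=: lag_mx Y)%MS.
  apply: frame_of_free => //; apply/row_subP => i; rewrite rowK.
  by rewrite -mem_lag_mx (basis_mem yY) ?mem_tnth.
have CZ : ((A + t *m B)%R :=: lag_mx Z)%MS.
  apply: frame_of_free.
    apply/row_subP => i; rewrite -[row i _]trmxK -mem_lag_mx -rowE.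
    by apply: (basis_mem zZ); apply/mapP; exists i; rewrite ?mem_enum.
  apply/row_freeP; exists (J *m B^T); rewrite mulmxA mulmxDl mulmxDl.
  rewrite -/(pairing A B) AB -!mulmxA (mulmxA B) -/(pairing B B).
  by rewrite (@pairing_lag _ _ X) ?BX // mulmx0 addr0.
rewrite (kashiwara_index_kappa BX AY CZ AB (nsform_sym t)).
exact: witt_of_nsform.
Qed.

Lemma exists_kappa (X Y Z : lag) :
  opposite X Y -> opposite Y Z -> opposite X Z -> exists t, is_kappa X Y Z t.
Proof.
move=> XY YZ XZ; have [B BX] := exists_frame X.
have [A AY AB] := exists_dual_frame BX XY.
have [C CZ CB] := exists_dual_frame BX XZ.
have /submxP[t CE] : (C - A <= B)%MS.
  by rewrite BX; apply: dual_frame_sub CB AB.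
have {}CE : C = A + t *m B by rewrite -CE addrC subrK.
have t_sym : t^T = t.
  have AC : pairing A C = t^T.
    rewrite CE /pairing linearD /= mulmxDr trmx_mul mulmxA -!/(pairing A _) AB mul1mx.
    by rewrite (@pairing_lag _ _ Y) ?AY // add0r.
  by rewrite -AC -(pairing_dual_sym BX AY CZ) // AC trmxK.
have t_unit : t \in unitmx.
  rewrite -row_free_unit -kermx_eq0 -submx0; apply/rV_subP => u /sub_kermxP ut.
  have : (u *m A <= lag_mx Y :&: lag_mx Z)%MS.
    rewrite sub_capmx -AY submxMl -CZ /=.
    by rewrite -[u *m A]addr0 -(mul0mx _ B) -ut -mulmxA -mulmxDr -CE submxMl.
  rewrite oppositeE in YZ; rewrite (eqP YZ) submx0 mulmx_free_eq0 ?(frame_free AY) //.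
  by rewrite submx0.
have t_ns : (t^T == t) && (t \in unitmx) by rewrite t_sym eqxx.
exists (NSForm t_ns), (cols_of B), (cols_of A); split.
- exact: basis_cols_of.
- exact: basis_cols_of.
- move=> mu nu; rewrite !row_cols_of /symp_form trmxK.
  by rewrite -mulmx_form_entry -/(pairing A B) AB mxE.
have := basis_cols_of CZ; congr (basis_of Z _).
apply: eq_map => nu; rewrite !row_cols_of CE -row_combination //; congr (_ + _).
by apply: eq_bigr => mu _; rewrite row_cols_of.
Qed.

End MaslovIndex.

(** * The two classes coincide *)

Section Maslov.
Variables (D : fieldType) (n : nat).
Hypothesis D_char : 2%N \notin [pchar D].
Hypothesis D_infinite : infinite_set [set: D]%classic.
Local Notation lag := (lagrangian D n).
Local Notation T := (opposition_graph D n).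

Lemma kappa_classE (X Y Z : lag) :
  opposite X Y -> opposite Y Z -> opposite X Z -> kappa_class X Y Z = kashiwara_index X Y Z.
Proof.
move=> XY YZ XZ; have [t tP] := exists_kappa XY YZ XZ.
have [|u uP wE] := @xgetPex _ 0
  [set w | exists2 t, is_kappa X Y Z t & w = witt_class t]%classic.
  by exists (witt_class t); exists t.
by rewrite /kappa_class wE (kashiwara_index_is_kappa D_char uP).
Qed.

(** On a simplex with a repeated vertex both sides are zero; on the others the
    vertices are pairwise opposite. *)
Lemma maslov_cochainE : @maslov_cochain D n = flag_cochain (T := T) (@kashiwara_index D n).
Proof.
rewrite /maslov_cochain /flag_cochain; congr zextend; apply/funext => s.
have opp i j : s i != s j -> opposite (s i) (s j).
  by have /forallP/(_ i)/forallP/(_ j) := valP s => /orP[/eqP->|//]; rewrite eqxx.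
have ord0E : ord0 = inord 0 :> 'I_3 by apply: val_inj; rewrite /= inordK.
have ord2E : ord_max = inord 2 :> 'I_3 by apply: val_inj; rewrite /= inordK.
have [/injectiveP s_inj|s_ninj] := boolP (injectiveb s).
  have neq i j : i != j -> s i != s j by move=> ij; apply: contra_neq ij => /s_inj.
  rewrite kappa_classE ?ord0E ?ord2E //; apply/opp/neq; by rewrite -val_eqE /= !inordK.
rewrite -[RHS]/(kashiwara_index (s (inord 0)) (s (inord 1)) (s (inord 2))).
have degenerate := @kashiwara_index_degenerate D n D_char D_infinite.
set x := s (inord 0); set y := s (inord 1); set z := s (inord 2).
have [xy|xy] := eqVneq x y; first by rewrite xy; have [] := degenerate y z.
have [xz|xz] := eqVneq x z; first by rewrite xz; have [] := degenerate z y.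
have [yz|yz] := eqVneq y z; first by rewrite yz; have [] := degenerate z x.
case/negP: s_ninj; apply/injectiveP => i j.
have sE (k : 'I_3) : s k = nth x [:: x; y; z] k.
  by rewrite -[in LHS](inord_val k); case: k => [[|[|[|]]]].
rewrite !sE => /eqP; rewrite nth_uniq //; first by move=> /eqP/val_inj.
by rewrite /= !inE negb_or xy xz yz.
Qed.
End Maslov.

Theorem corollary8p7 (D : fieldType) (n : nat)
    (D_char : 2%N \notin [pchar D]) (D_infinite : infinite_set [set: D]%classic)
    (X0 : lagrangian D n)
    (P : gresolution (Sp D n)) (phi : bar_comparison P) :
  kashiwara_class phi X0 = maslov_class P.
Proof.
set T := opposition_graph D n.
have T_cone (s : seq T) : exists w : T, all (adj w) s := common_opposite D_infinite s.
have index_inv := @kashiwara_index_inv _ n D_char D_infinite.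
have index_cocycle := @kashiwara_index_cocycle _ n D_char D_infinite.
have f0_cocycle : is_group_cocycle (of_inhomogeneous phi (kashiwara_cocycle X0)) :=
  is_group_cocycle_orbit (T := T) phi X0 index_inv index_cocycle.
have f0_maslov : bicohomologous 2%N
    (const_pullback (@flag_aug _ T) (of_inhomogeneous phi (kashiwara_cocycle X0)))
    (of_invariant (@maslov_cochain D n)).
  rewrite maslov_cochainE //.
  exact: (orbit_class (T := T) phi X0 index_inv index_cocycle).
pose p0 : flag_complex T 0%N := << point_simplex (X0 : T) >>.
apply/seteqP; split=> f.
  move=> ff0; split; last first.
    apply: (const_pullback_coboundary (eps := @flag_aug _ T) _ _ ff0 f0_maslov).
      exact: flag_aug_act.
    exact: flag_aug_bd.
  have [[f0B f0_inv] f0_bd] := f0_cocycle.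
  have [a [aB a_inv] fE] := ff0.
  split; first split.
  - by move=> x y; rewrite !fE f0B raddfB aB !opprD addrACA.
  - by move=> g x; rewrite !fE f0_inv bd_equivariant a_inv.
  - by move=> x; rewrite fE f0_bd bdK add0r -(subrr 0) aB subrr.
move=> [f_cocycle f_maslov].
apply: (const_pullback_inj (eps := @flag_aug _ T) (y0 := p0)).
- exact: flag_augU.
- exact: flag_aug_act.
- exact: flag_aug_bd.
- exact: flag_exact0.
- exact: flag_exactS.
exact: bicohomologous_subr f_maslov f0_maslov.
Qed.
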